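(* Consider the $N$-user Markov-modeled downlink with randomly delayed ARQ feedback described in the context (with $p>r$), and let $\mathcal{C}\subseteq\mathbb{R}^N$ be its capacity region. Let $p_s=\frac{r}{1-(p-r)}$ and, for an integer $n$, $$C_{\mathrm{sum}}^{\mathrm{genie}}(n)=\sum_{l=0}^{\infty}\Big[(1-(1-p_s)^n)T^l(p)+(1-p_s)^nT^l(r)\Big]P(D\le l)\prod_{d=0}^{l-1}P(D>d),$$ $$C_{\mathrm{sum}}(2)=\sum_{l=0}^{\infty}\Big[p_sT^l(p)+(1-p_s)p_s\Big]P(D\le l)\prod_{d=0}^{l-1}P(D>d).$$ (Outer bound.) An outer bound on the capacity region is given by the complement of the polyhedron $$\mathcal{P}=\Big\{(x_1,\ldots,x_N): x_i\ge0\ \forall i,\ \ \sum_{i\in S}x_i\le C_{\mathrm{sum}}^{\mathrm{genie}}(|S|)\ \ \forall S\subseteq\{1,\ldots,N\}\Big\},$$ i.e. no point outside $\mathcal{P}$ is achievable: $\mathcal{C}\subseteq\mathcal{P}$. (Inner bound.) An inner bound on the capacity region is the convex hull $$H_{\mathrm{convex}}\big(O,\{X_i\}_{i\in\{1,\ldots,N\}},\{Y_{j,k}\}_{j,k\in\{1,\ldots,N\},\,j\ne k}\big)\subseteq\mathcal{C},$$ where $O=(0,\ldots,0)$, $X_i\in\mathbb{R}^N$ has $p_s$ at the $i$-th location and $0$ elsewhere, and $Y_{j,k}\in\mathbb{R}^N$ has $\frac{C_{\mathrm{sum}}(2)}{2}$ at locations $j$ and $k$ and $0$ elsewhere.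
   Context: Model. There are $N$ users. Time is slotted and slots are indexed in DEcreasing order $m,m-1,\ldots,1$, where $m$ is the horizon (slot $m$ is first, slot $1$ is last). The channel state of user $i$ in slot $t$ is $S_t(i)\in\{0,1\}$ ($1$ = ON, $0$ = OFF). The channels are independent across users, and each is a Markov chain with $P(S_t(i)=1\mid S_{t+1}(i)=1)=p$ and $P(S_t(i)=1\mid S_{t+1}(i)=0)=r$, with $p,r\in[0,1]$, $p>r$ and $p+(1-r)<2$; the initial distribution is the stationary one, $P(S_m(i)=1)=p_s$. Scheduling and feedback. In each slot $t$ the scheduler, not knowing the channel states, schedules one user $a_t\in\{1,\ldots,N\}$. The scheduled user generates the ARQ feedback bit $f_t=S_t(a_t)$, which arrives, without error and stamped with its originating slot, at the end of slot $t-D(a_t,t)$ (delay $0$ means it arrives at the end of slot $t$ itself). The delays $D(i,t)$ are i.i.d. across users and time with probability mass function $P_D$ on $\{0,1,2,\ldots\}$ and independent of the channels; $D$ denotes a generic delay with this law. Write $T(x)=xp+(1-x)r$, $T^0(x)=x$, $T^u=T\circ T^{u-1}$; empty products equal $1$. Policies and throughput. The belief $\pi_k(i)$ is the conditional probability that user $i$'s channel is ON in slot $k$ given all feedback arrived by the beginning of slot $k$. A scheduling policy $\mathfrak{A}$ chooses $a_k$ in each slot $k$ on the basis of the information available to the scheduler (arrived time-stamped feedback and past decisions); time sharing between policies, and idling (scheduling no user) in a slot, are allowed. The throughput of user $i$ under $\mathfrak{A}$ is $$\mu_i^{\mathfrak{A}}=\lim_{m\to\infty}\frac{E\big[\sum_{k=1}^m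 \pi_k(a_k)\,\mathbf{1}\{a_k=i\}\big]}{m}.$$ The capacity region is $\mathcal{C}=\bigcup_{\mathfrak{A}}\{(\mu_1^{\mathfrak{A}},\ldots,\mu_N^{\mathfrak{A}})\}$, the union over all scheduling policies. $H_{\mathrm{convex}}(X)$ denotes the convex hull of a finite set of points $X$. The numbers $C_{\mathrm{sum}}(2)$ and $C_{\mathrm{sum}}^{\mathrm{genie}}(n)$ are the sum capacities (maximal limiting expected total throughput) of the 2-user downlink and of the $n$-user system in which each slot's feedback contains the states of all users, respectively. *)

(* Defs.v *)
From mathcomp Require Import all_boot all_order all_algebra.
From mathcomp Require Import all_classical all_reals all_analysis.

Set Implicit Arguments.
Unset Strict Implicit.
Unset Printing Implicit Defensive.

Import Order.TTheory GRing.Theory Num.Theory.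
Import numFieldNormedType.Exports.

Local Open Scope classical_set_scope.
Local Open Scope ring_scope.

(* Slots run downwards: m is the first slot, 1 the last one, so that time
   passes as the slot number decreases.  The users are the elements of 'I_N,
   [true] is the ON state, and [None : option 'I_N] is an idle slot. *)

Section channel.
Context (R : realType) (p r : R).

Definition stat_on : R := r / (1 - (p - r)).

Definition evolve (x : R) : R := x * p + (1 - x) * r.

Definition trans (b b' : bool) : R :=
  let on := if b then p else r in if b' then on else 1 - on.

End channel.

(* The downlink over the horizon m.  Only the slots 1, ..., m of [chan] and
   [delay] are constrained (and used). *)
Record downlink (R : realType) (N : nat) (p r : R) (PD : probability nat R)
    (m : nat) := Downlink {
  dl_disp : measure_display;
  dl_space : measurableType dl_disp;
  dl_prob : probability dl_space R;
  chan : 'I_N -> nat -> {RV dl_prob >-> bool};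
  delay : 'I_N -> nat -> {RV dl_prob >-> nat};
  chan_init : forall i, (0 < m)%N ->
    dl_prob [set w | chan i m w] = (stat_on p r)%:E;
  (* the Markov property and the transition probabilities, multiplied out so
     that histories of probability zero need no special treatment *)
  chan_markov : forall i (s : nat -> bool) (t : nat), (1 <= t < m)%N ->
    dl_prob [set w | forall t', (t <= t' <= m)%N -> chan i t' w = s t'] =
    (dl_prob [set w | forall t', (t < t' <= m)%N -> chan i t' w = s t'] *
     (trans p r (s t.+1) (s t))%:E)%E;
  delay_law : forall i (t : nat) (A : set nat), (1 <= t <= m)%N ->
    dl_prob [set w | A (delay i t w)] = PD A;
  (* the N channel processes and all the delays are mutually independent *)
  dl_indep : forall (s : 'I_N -> nat -> bool) (d : 'I_N -> nat -> nat),
    dl_prob [set w | forall i t, (1 <= t <= m)%N ->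
                       chan i t w = s i t /\ delay i t w = d i t] =
    ((\prod_(i < N)
        dl_prob [set w | forall t, (1 <= t <= m)%N -> chan i t w = s i t]) *
     \prod_(i < N) \prod_(1 <= t < m.+1)
        dl_prob [set w | delay i t w = d i t])%E
}.

(* A feedback bit as known to the scheduler once it has arrived:
   (originating slot, scheduled user, bit, arrival slot). *)
Definition report (N : nat) : Type := (nat * 'I_N * bool * nat)%type.

(* [rule m ds fb u] is the decision taken in slot [m - size ds], where [ds]
   lists the decisions of the slots m, m - 1, ... already past and [fb] the
   feedback arrived so far.  The private random seed [u], independent of the
   channels and of the delays, allows for time sharing between policies. *)
Record policy (R : realType) (N : nat) := Policy {
  seed_disp : measure_display;
  seed : measurableType seed_disp;
  seed_law : probability seed R;
  rule : nat -> seq (option 'I_N) -> seq (report N) -> seed -> option 'I_N;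
  rule_measurable : forall m ds fb a, measurable [set u | rule m ds fb u = a]
}.

Section operation.
Context (N : nat).
Implicit Types (S : 'I_N -> nat -> bool) (D : 'I_N -> nat -> nat).

(* The feedback generated in slot t arrives at the end of slot t - D, hence is
   available at the beginning of slot k iff k < t - D. *)
Definition arrived S D (m k : nat) (ds : seq (option 'I_N)) : seq (report N) :=
  pmap (fun j => let t := (m - j)%N in
          if nth None ds j is Some i then
            if (k < t - D i t)%N then Some (t, i, S i t, (t - D i t)%N)
            else None
          else None)
       (iota 0 (size ds)).

Fixpoint decisions (f : seq (option 'I_N) -> seq (report N) -> option 'I_N)
    S D (m n : nat) : seq (option 'I_N) :=
  if n is n'.+1 then
    let ds := decisions f S D m n' in
    rcons ds (f ds (arrived S D m (m - n') ds))
  else [::].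

End operation.

Section throughput.
Context (R : realType) (N : nat) (p r : R) (PD : probability nat R).
Context (A : policy R N) (m : nat) (L : downlink N p r PD m).

Definition joint_law : probability (dl_space L * seed A)%type R :=
  (dl_prob L \x seed_law A)%E.

Definition past (k : nat) (w : dl_space L * seed A) : seq (option 'I_N) :=
  decisions (fun ds fb => rule m ds fb w.2)
    (fun i t => chan L i t w.1) (fun i t => delay L i t w.1) m (m - k).

Definition feedback (k : nat) (w : dl_space L * seed A) : seq (report N) :=
  arrived (fun i t => chan L i t w.1) (fun i t => delay L i t w.1) m k
    (past k w).

Definition action (k : nat) (w : dl_space L * seed A) : option 'I_N :=
  rule m (past k w) (feedback k w) w.2.

(* conditional probability given the (discrete) random variable [feedback k] *)
Definition belief (k : nat) (i : 'I_N) (w : dl_space L * seed A) : R :=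
  fine (joint_law [set w' | chan L i k w'.1 /\ feedback k w' = feedback k w]) /
  fine (joint_law [set w' | feedback k w' = feedback k w]).

Definition reward (i : 'I_N) (w : dl_space L * seed A) : R :=
  \sum_(1 <= k < m.+1) belief k i w * (action k w == Some i)%:R.

Definition throughput (i : 'I_N) : R :=
  fine 'E_joint_law[reward i] / m%:R.

End throughput.

(* A policy contributes a point only if all its throughput limits exist. *)
Definition capacity_region (R : realType) (N : nat) (p r : R)
    (PD : probability nat R) (L : forall m, downlink N p r PD m) :
    set 'rV[R]_N :=
  [set x : 'rV[R]_N | exists A : policy R N,
     forall i, throughput A (L m) i @[m --> \oo] --> x 0 i].

Section bounds.
Context (R : realType) (p r : R) (PD : probability nat R).

(* When feedback is generated in every slot, this is the probability that the
   most recent feedback available at the beginning of a slot originates l + 1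
   slots earlier. *)
Definition latest_prob (l : nat) : R :=
  fine (PD [set d | (d <= l)%N]) *
  \prod_(0 <= d < l) fine (PD [set d' | (d < d')%N]).

Definition Csum_genie (n : nat) : R :=
  let off := (1 - stat_on p r) ^+ n in
  limn (series (fun l =>
    ((1 - off) * iter l (evolve p r) p + off * iter l (evolve p r) r)
    * latest_prob l)).

Definition Csum2 : R :=
  let ps := stat_on p r in
  limn (series (fun l =>
    (ps * iter l (evolve p r) p + (1 - ps) * ps) * latest_prob l)).

Context (N : nat).

Definition outer_polyhedron : set 'rV[R]_N :=
  [set x : 'rV[R]_N | (forall i, 0 <= x 0 i) /\
     forall S : {set 'I_N}, \sum_(i in S) x 0 i <= Csum_genie #|S|].

Definition single_user_point (i : 'I_N) : 'rV[R]_N :=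
  \row_l (if l == i then stat_on p r else 0).

Definition two_user_point (j k : 'I_N) : 'rV[R]_N :=
  \row_l (if (l == j) || (l == k) then Csum2 / 2 else 0).

Definition inner_points : set 'rV[R]_N :=
  [set x | [\/ x = 0, exists i, x = single_user_point i |
            exists j k, j != k /\ x = two_user_point j k]].

End bounds.

Definition convex_hull (R : realType) (V : lmodType R) (X : set V) : set V :=
  smallest (@convex_set R V) X.

(* Main.v *)
(* A past report enters the later decisions only through the slot, the user
   and the bit it displays, so that, given the feedback, the channels are
   independent of the delays, of the seed and of the decision.  Hence the
   expectation of belief times decision is the probability that the scheduled
   channel is ON, which is affine in the law of the seed: time sharing makes
   the capacity region convex.

   Fix a slot k and let k + l + 1 be the slot of the most recent report
   available in slot k.  A user is chosen without knowledge of its future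
   delay, so the delays met are i.i.d. and, even given the channels, this
   happens with probability P(D <= l) \prod_(d < l) P(D > d).  The decision in
   slot k then depends only on channel states up to slot k + l + 1, and serving
   a user of S succeeds with probability at most T^l(p) if some user of S was
   ON in that slot, and T^l(r) otherwise; averaging gives the genie bound.  For
   two users the bound is attained by staying with a user last seen ON and
   leaving a user last seen OFF: the user chosen was ON in the reported slot
   iff one of the two was.  Starting with either user with probability 1/2
   makes the two rates equal, and C_sum(2) = C_sum^genie(2) by stationarity. *)
Require Import Defs.
From mathcomp Require Import all_boot all_order all_algebra.
From mathcomp Require Import all_classical all_reals all_analysis.
From mathcomp Require Import perm measurable_realfun ring lra zify.
Set Implicit Arguments.
Unset Strict Implicit.
Unset Printing Implicit Defensive.
Import Order.TTheory GRing.Theory Num.Theory.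
Import numFieldNormedType.Exports.
Local Open Scope classical_set_scope.
Local Open Scope ring_scope.

(** * Conditional expectations over finitely many slots *)

Section sweep.
Context (T : Type).

Definition set_slot (x : nat -> T) (t : nat) (a : T) : nat -> T :=
  fun t' => if t' == t then a else x t'.

(** Slot numbers fall as time passes, so this says that both trajectories have the same history
    before slot [t]. *)
Definition agree_above (t : nat) (x y : nat -> T) :=
  forall t', (t < t')%N -> x t' = y t'.

Lemma agree_above_set t x y a : agree_above t x (set_slot y t.+1 a) ->
  agree_above t.+1 x y /\ x t.+1 = a.
Proof.
move=> xy; split=> [t' tt'|]; last by rewrite xy// /set_slot eqxx.
by rewrite xy ?(ltnW tt')// /set_slot gtn_eqF.
Qed.

End sweep.

Section sweep_theory.
Context (R : realType) (T : finType).
Implicit Types (x y : nat -> T) (F G : (nat -> T) -> R).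

(* [K x t a] is the probability of the value a in slot t given the values x of
   the earlier slots t + 1, t + 2, ...; [sweep K t F x] is then the conditional
   expectation of F given these values. *)
Definition is_kernel (K : (nat -> T) -> nat -> T -> R) :=
  (forall x t a, 0 <= K x t a) /\ (forall x t, \sum_a K x t a = 1).

Fixpoint sweep (K : (nat -> T) -> nat -> T -> R) (t : nat) F x : R :=
  if t is t'.+1 then \sum_a K x t a * sweep K t' F (set_slot x t a) else F x.

Context (K : (nat -> T) -> nat -> T -> R) (hK : is_kernel K).

Lemma eq_sweep t F G x :
  (forall y, agree_above t y x -> F y = G y) -> sweep K t F x = sweep K t G x.
Proof.
elim: t x => [|t IH] x FG /=; first exact: FG.
apply: eq_bigr => a _; congr (_ * _); apply: IH => y hy; have [yx _] := agree_above_set hy.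
exact: FG.
Qed.

Lemma ler_sweep t F G x :
  (forall y, agree_above t y x -> F y <= G y) -> sweep K t F x <= sweep K t G x.
Proof.
elim: t x => [|t IH] x FG /=; first exact: FG.
apply: ler_sum => a _; apply: ler_wpM2l; first exact: hK.1.
by apply: IH => y hy; have [yx _] := agree_above_set hy; exact: FG.
Qed.

Lemma sweep_cst t F x c :
  (forall y, agree_above t y x -> F y = c) -> sweep K t F x = c.
Proof.
move=> Fc; rewrite (eq_sweep (G := fun=> c))//.
elim: t x {Fc} => [//|t IH] x /=.
by under eq_bigr do rewrite IH; rewrite -mulr_suml hK.2 mul1r.
Qed.

Lemma sweepZ t c F x : sweep K t (fun y => c * F y) x = c * sweep K t F x.
Proof.
elim: t x => [//|t IH] x /=; rewrite mulr_sumr; apply: eq_bigr => a _.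
by rewrite IH mulrCA.
Qed.

Lemma sweep_sum t (I : Type) (s : seq I) (P : pred I)
    (F : I -> (nat -> T) -> R) x :
  sweep K t (fun y => \sum_(i <- s | P i) F i y) x =
  \sum_(i <- s | P i) sweep K t (F i) x.
Proof.
elim: t x => [//|t IH] x /=; rewrite exchange_big/=; apply: eq_bigr => a _.
by rewrite IH mulr_sumr.
Qed.

Lemma sweepD t F G x :
  sweep K t (fun y => F y + G y) x = sweep K t F x + sweep K t G x.
Proof.
elim: t x => [//|t IH] x /=; rewrite -big_split; apply: eq_bigr => a _ /=.
by rewrite IH mulrDr.
Qed.

(** Tower property: further averaging over the slots above [t] sees [F] and [G] only through their
    conditional means given those slots. *)
Lemma sweep_tower t m F G x : (t <= m)%N ->
  (forall y, sweep K t F y = sweep K t G y) -> sweep K m F x = sweep K m G x.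
Proof.
move=> tm FG; rewrite -(subnKC tm); elim: (m - t)%N x => [|n IH] x.
  by rewrite addn0.
by rewrite addnS /=; apply: eq_bigr => a _; rewrite IH.
Qed.

Lemma sweep_ge0 t F x : (forall y, 0 <= F y) -> 0 <= sweep K t F x.
Proof.
by move=> F0; rewrite -[leLHS](sweep_cst (t := t) (F := fun=> 0) (x := x))//;
  apply: ler_sweep.
Qed.

End sweep_theory.

Lemma sweep_swap (R : realType) (T U : finType)
    (K : (nat -> T) -> nat -> T -> R) (H : (nat -> U) -> nat -> U -> R)
    t u (F : (nat -> T) -> (nat -> U) -> R) x y :
  sweep K t (fun a => sweep H u (F a) y) x =
  sweep H u (fun b => sweep K t (F^~ b) x) y.
Proof.
elim: t x => [//|t IH] x /=; rewrite sweep_sum; apply: eq_bigr => a _.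
by rewrite IH sweepZ.
Qed.

Lemma sum_ffun_prod (R : realType) (I T : finType) (f : I -> T -> R) :
  \sum_(a : {ffun I -> T}) \prod_i f i (a i) = \prod_i \sum_b f i b.
Proof. by rewrite bigA_distr_bigA. Qed.

Lemma sum_ffun_prod1 (R : realType) (I T : finType) (f : I -> T -> R) g i :
  (forall j, \sum_b f j b = 1) ->
  \sum_(a : {ffun I -> T}) (\prod_j f j (a j)) * g (a i) = \sum_b f i b * g b.
Proof.
(* Attaching [g] to the coordinate [i] alone keeps the product form, and every other coordinate sums
   to 1. *)
move=> f1; pose h j b := f j b * (if j == i then g b else 1).
transitivity (\sum_(a : {ffun I -> T}) \prod_j h j (a j)).
  apply: eq_bigr => a _; rewrite big_split/=; congr (_ * _).
  by rewrite (bigD1 i)//= eqxx big1 ?mulr1// => j; case: eqP.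
rewrite sum_ffun_prod (bigD1 i)//= [X in _ * X]big1 ?mulr1.
  by apply: eq_bigr => b _; rewrite /h eqxx.
move=> j /negbTE ji; rewrite -[RHS](f1 j).
by apply: eq_bigr => b _; rewrite /h ji mulr1.
Qed.

(* The user [c x] read in a slot may depend on the earlier slots: the values
   read are still independent. *)
Lemma sweep_prod_adapted (R : realType) (I B : finType) (w : B -> R)
    (h : nat -> B -> R) (c : nat -> (nat -> {ffun I -> B}) -> I) t x :
  (forall b, 0 <= w b) -> \sum_b w b = 1 ->
  (forall t x y, agree_above t x y -> c t x = c t y) ->
  sweep (fun _ _ (a : {ffun I -> B}) => \prod_i w (a i)) t
    (fun x => \prod_(1 <= s < t.+1) h s (x s (c s x))) x =
  \prod_(1 <= s < t.+1) \sum_b w b * h s b.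
Proof.
move=> w0 w1 hc; elim: t x => [|t IH] x; first by rewrite /= !big_geq.
rewrite big_nat_recr//= -(@sum_ffun_prod1 R I B (fun=> w) (h t.+1) (c t.+1 x))//.
rewrite mulr_sumr; apply: eq_bigr => a _.
(* The factor of slot [t + 1] is constant in the remaining sweep, because [c] looks only at earlier
   slots. *)
rewrite -(IH (set_slot x t.+1 a)) mulrCA; congr (_ * _).
rewrite mulrC -sweepZ; apply: eq_sweep => y hy; have [yx ya] := agree_above_set hy.
by rewrite big_nat_recr//= mulrC ya (hc _ _ _ yx).
Qed.

(** * The Markov channels *)

Section channel_kernel.
Context (R : realType) (p r : R).
Hypotheses (hp : 0 <= p <= 1) (hr : 0 <= r <= 1) (hpr : r < p)
  (hnd : p + (1 - r) < 2).

Local Notation ps := (stat_on p r).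
Local Notation T := (evolve p r).

Let den_gt0 : 0 < 1 - (p - r).
Proof. by move: hnd; lra. Qed.

Lemma stat_on_ge0 : 0 <= ps.
Proof. by apply: divr_ge0; [move: hr; lra|exact: ltW]. Qed.

Lemma stat_on_le1 : ps <= 1.
Proof. by rewrite ler_pdivrMr// mul1r; move: hp; lra. Qed.

Lemma evolve_stat : T ps = ps.
Proof.
have d0 : 1 - (p - r) != 0 by rewrite gt_eqF.
have e : ps * (1 - (p - r)) = r by rewrite /stat_on divfK.
rewrite /evolve; lra.
Qed.

Lemma iter_evolve_stat n : iter n T ps = ps.
Proof. by elim: n => //= n ->; rewrite evolve_stat. Qed.

Lemma iter_evolve_conv n a x y :
  iter n T (a * x + (1 - a) * y) = a * iter n T x + (1 - a) * iter n T y.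
Proof. by elim: n => //= n ->; rewrite /evolve; ring. Qed.

Lemma iter_evolve_stat_conv l : ps * iter l T p + (1 - ps) * iter l T r = ps.
Proof.
by rewrite -iter_evolve_conv -{3}(iter_evolve_stat l) -{3}evolve_stat.
Qed.

Lemma ler_iter_evolve n x y : x <= y -> iter n T x <= iter n T y.
Proof.
move=> xy; elim: n => //= n IH; rewrite /evolve.
have := ler_wpM2r (_ : 0 <= p - r) IH.
by move: hpr => ? /(_ ltac:(lra)); lra.
Qed.

Lemma iter_evolve01 n x : 0 <= x <= 1 -> 0 <= iter n T x <= 1.
Proof.
move=> x01; elim: n => //= n /andP[]; set y := iter _ _ _ => y0 y1.
have := mulr_ge0 y0 (_ : 0 <= p - r); have := mulr_ge0 (_ : 0 <= 1 - y) (_ : 0 <= p - r).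
move: hp hr hpr => ? ? ? /(_ ltac:(lra) ltac:(lra)) ? /(_ ltac:(lra)) ?.
by rewrite /evolve; apply/andP; split; lra.
Qed.

Lemma evolve_bool (b : bool) : T b%:R = if b then p else r.
Proof. by rewrite /evolve; case: b => /=; ring. Qed.

Context (N m : nat).
Local Notation slot := {ffun 'I_N -> bool}.

(** The first slot [m] has no predecessor, so the stationary law takes the place of the transition
    probabilities there. *)
Definition user_kernel (x : nat -> slot) (t : nat) (i : 'I_N) (b : bool) : R :=
  if (t < m)%N then trans p r (x t.+1 i) b else if b then ps else 1 - ps.

Definition chan_kernel (x : nat -> slot) (t : nat) (a : slot) : R :=
  \prod_i user_kernel x t i (a i).

Lemma user_kernel_ge0 x t i b : 0 <= user_kernel x t i b.
Proof.
rewrite /user_kernel /trans; have := stat_on_ge0; have := stat_on_le1.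
move: hp hr => /andP[? ?] /andP[? ?] ps1 ps0.
by case: (_ < _)%N; case: b => //; try case: (x _ _); rewrite ?subr_ge0.
Qed.

Lemma sum_user_kernel x t i : \sum_b user_kernel x t i b = 1.
Proof. by rewrite big_bool /user_kernel /trans; case: (t < m)%N; rewrite /= addrC subrK. Qed.

Lemma chan_is_kernel : is_kernel chan_kernel.
Proof.
split=> x t => [a|]; first by apply: prodr_ge0 => i _; exact: user_kernel_ge0.
rewrite sum_ffun_prod big1// => i _; exact: sum_user_kernel.
Qed.

Local Notation E := (sweep chan_kernel m).

Lemma sweep_slot t (F : (nat -> slot) -> R) (g : bool -> R) i x : (0 < t)%N ->
  (forall y z, agree_above t y z -> F y = F z) ->
  sweep chan_kernel t (fun y => F y * g (y t i)) x =
  F x * \sum_b user_kernel x t i b * g b.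
Proof.
case: t => // t _ hF /=.
rewrite -(sum_ffun_prod1 _ _ (sum_user_kernel x t.+1)) mulr_sumr.
apply: eq_bigr => a _; rewrite mulrCA; congr (_ * _).
apply: (sweep_cst chan_is_kernel) => y hy; have [yx ->] := agree_above_set hy.
by rewrite (hF _ _ yx).
Qed.

(** Markov property: given the earlier slots, the mean state in slot [t] is [T] of the state in slot
    [t + 1], and iterates of the affine map [T] commute with averaging. *)
Lemma chan_predict1 t n (F : (nat -> slot) -> R) i x : (0 < t < m)%N ->
  (forall y z, agree_above t y z -> F y = F z) ->
  E (fun y => F y * iter n T (y t i)%:R) x =
  E (fun y => F y * iter n.+1 T (y t.+1 i)%:R) x.
Proof.
move=> /andP[t0 tm] hF; apply: (sweep_tower _ (ltnW tm)) => y.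
rewrite (sweep_slot (fun b : bool => iter n T b%:R))//.
rewrite [RHS](sweep_cst chan_is_kernel (c := F y * iter n.+1 T (y t.+1 i)%:R)); last first.
  by move=> z zy; rewrite (hF _ _ zy) zy.
congr (_ * _); rewrite iterSr evolve_bool big_bool/= /user_kernel tm /trans.
by rewrite -iter_evolve_conv; congr iter; ring.
Qed.

(** One-step prediction iterated back to slot [k + l + 1]. The weight [F] may depend on that slot
    and on all earlier ones, as a decision based on its report does. *)
Lemma chan_predict k l (F : (nat -> slot) -> R) i x :
  (0 < k)%N -> (k + l < m)%N ->
  (forall y z, agree_above (k + l) y z -> F y = F z) ->
  E (fun y => F y * (y k i)%:R) x =
  E (fun y => F y * iter l.+1 T (y (k + l).+1 i)%:R) x.
Proof.
move=> k0; elim: l => [|l IH] klm hF.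
  by rewrite addn0 in klm hF *; apply: (@chan_predict1 k 0) => //; rewrite k0.
rewrite addnS in klm hF *; rewrite IH ?(ltnW klm)//; last first.
  by move=> y z yz; apply: hF => t kt; apply: yz; exact: ltnW.
by apply: (@chan_predict1 (k + l).+1 l.+1) => //; rewrite ltn0Sn.
Qed.

Lemma chan_stationary k i c x : (0 < k <= m)%N ->
  E (fun y => c * (y k i)%:R) x = c * ps.
Proof.
move=> /andP[k0 km].
(* The state is predicted from the first slot [m], whose law is a fixed point of [T]. *)
have -> : E (fun y => c * (y k i)%:R) x =
    E (fun y => c * iter (m - k) T (y m i)%:R) x.
  case: (ltngtP k m) km => [lt _||-> _]//; last by rewrite subnn.
  rewrite (@chan_predict k (m - k).-1)//; last by lia.
  by rewrite prednK ?subn_gt0// -addnS prednK ?subn_gt0// subnKC// ltnW.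
have m0 : (0 < m)%N by exact: leq_trans km.
rewrite (sweep_slot (fun b : bool => iter (m - k) T b%:R))//.
rewrite big_bool/= /user_kernel ltnn -iter_evolve_conv mulr1 mulr0 addr0.
by rewrite iter_evolve_stat.
Qed.

(** In each slot the states of the users are independent and stationary; the induction goes from
    slot [m] downwards. *)
Lemma chan_product t (g : 'I_N -> bool -> R) x : (0 < t <= m)%N ->
  E (fun y => \prod_i g i (y t i)) x =
  \prod_i (ps * g i true + (1 - ps) * g i false).
Proof.
have step s y h : (0 < s)%N -> sweep chan_kernel s (fun y => \prod_i h i (y s i)) y =
    \prod_i \sum_b user_kernel y s i b * h i b.
  case: s => // s _ /=; rewrite -sum_ffun_prod; apply: eq_bigr => a _.
  rewrite (sweep_cst chan_is_kernel (c := \prod_i h i (a i))).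
    by rewrite big_split.
  by move=> z hz; have [_ ->] := agree_above_set hz.
move=> /andP[t0 tm]; rewrite -(subKn tm) in t0 *.
elim: (m - t)%N (leq_subr t m) g t0 => [|n IH] nm g t0.
  rewrite subn0 in t0 *; rewrite (step _ _ g)//; apply: eq_bigr => i _.
  by rewrite big_bool/= /user_kernel ltnn.
have e : (m - n = (m - n.+1).+1)%N by rewrite subnSK.
have lt : (m - n.+1 < m)%N by lia.
(* [g'] is [g] averaged over one transition; by stationarity it has the same mean as [g]. *)
pose g' i (c : bool) := \sum_b trans p r c b * g i b.
transitivity (E (fun y => \prod_i g' i (y (m - n)%N i)) x).
  apply: (@sweep_tower _ _ _ (m - n.+1)%N) => [|y]; first exact: leq_subr.
  rewrite (step _ y g)//.
  rewrite [RHS](sweep_cst chan_is_kernel (c := \prod_i g' i (y (m - n)%N i))); last first.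
    by move=> z zy; rewrite zy ?e.
  by apply: eq_bigr => i _; rewrite /g' /user_kernel lt e.
rewrite (IH _ g')// ?(ltnW nm)// ?e//; apply: eq_bigr => i _.
rewrite /g' !big_bool/= /trans.
have := evolve_stat; rewrite /evolve => ev.
rewrite -[in RHS]ev; ring.
Qed.

(** The best probability of success with a user of [V] when the states [a] of all users were seen
    [l + 1] slots earlier. *)
Definition genie_gain (V : {set 'I_N}) (l : nat) (a : slot) : R :=
  if [exists i in V, a i] then iter l T p else iter l T r.

Lemma genie_gain_ge (V : {set 'I_N}) l (a : slot) i : i \in V -> iter l.+1 T (a i)%:R <= genie_gain V l a.
Proof.
move=> iV; rewrite iterSr evolve_bool /genie_gain.
have rp := ler_iter_evolve l (ltW hpr).
case ai : (a i); last by case: ifP.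
by rewrite ifT//; apply/existsP; exists i; rewrite iV.
Qed.

(** The bracket of the [l]-th term in the genie capacity. *)
Definition genie_mean (n l : nat) : R :=
  (1 - (1 - ps) ^+ n) * iter l T p + (1 - ps) ^+ n * iter l T r.

Lemma genie_mean01 n l : 0 <= genie_mean n l <= 1.
Proof.
have o1 : 0 <= (1 - ps) ^+ n <= 1.
  have := stat_on_ge0; have := stat_on_le1 => *.
  by rewrite exprn_ge0 ?exprn_ile1//; lra.
have := iter_evolve01 l hp; have := iter_evolve01 l hr; rewrite /genie_mean.
set a := iter l T p; set b := iter l T r; set c := _ ^+ n in o1 * => b01 a01.
have := mulr_ge0 (_ : 0 <= 1 - c) (_ : 0 <= a); have := mulr_ge0 (_ : 0 <= 1 - c) (_ : 0 <= 1 - a).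
have := mulr_ge0 (_ : 0 <= c) (_ : 0 <= b); have := mulr_ge0 (_ : 0 <= c) (_ : 0 <= 1 - b).
do 4! move=> /(_ ltac:(lra) ltac:(lra)) ?.
by apply/andP; split; lra.
Qed.

(** For one user the mean is exactly [ps], by stationarity; more users only lower the weight
    [(1 - ps) ^+ n] of the smaller value [T^l(r)]. *)
Lemma genie_mean_ge n l : (0 < n)%N -> ps <= genie_mean n l.
Proof.
move=> n0; have := iter_evolve_stat_conv l.
have o1 : (1 - ps) ^+ n <= 1 - ps.
  have := stat_on_ge0; have := stat_on_le1 => *.
  by case: n n0 => // n _; rewrite exprS ler_piMr ?exprn_ile1//; lra.
have := ler_iter_evolve l (ltW hpr); rewrite /genie_mean.
set a := iter l T p; set b := iter l T r; set c := _ ^+ n in o1 *; nra.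
Qed.

Lemma mean_genie_gain (V : {set 'I_N}) l t x : (0 < t <= m)%N ->
  E (fun y => genie_gain V l (y t)) x = genie_mean #|V| l.
Proof.
(* The product of the [g i] is the indicator that every user of [V] is OFF, and the gain is affine
   in it. *)
move=> tm; pose g i (b : bool) : R := (~~ ((i \in V) && b))%:R.
pose d := iter l T r - iter l T p.
have Eg : E (fun y => \prod_i g i (y t i)) x = (1 - ps) ^+ #|V|.
  rewrite chan_product// -prodr_const [RHS]big_mkcond/=; apply: eq_bigr => i _.
  by rewrite /g; case: (i \in V) => /=; ring.
transitivity (E (fun y => iter l T p + d * \prod_i g i (y t i)) x).
  apply: eq_sweep => y _; rewrite /genie_gain; case: ifPn => [/existsP[i /andP[iV yi]]|].
    by rewrite (bigD1 i)//= /g iV yi/= mul0r mulr0 addr0.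
  move=> /existsPn h; rewrite big1 => [|i _]; first by rewrite /d; ring.
  by rewrite /g h.
rewrite sweepD sweepZ Eg (sweep_cst chan_is_kernel (c := iter l T p))//.
by rewrite /d /genie_mean; ring.
Qed.

End channel_kernel.

(** * Decisions and feedback *)

Section decisions_theory.
Context (N : nat).
Implicit Types (S : 'I_N -> nat -> bool) (D : 'I_N -> nat -> nat).
Implicit Types (f : seq (option 'I_N) -> seq (report N) -> option 'I_N).

Lemma size_decisions f S D m n : size (decisions f S D m n) = n.
Proof. by elim: n => //= n IH; rewrite size_rcons IH. Qed.

Definition reports f S D m k : seq (report N) :=
  arrived S D m k (decisions f S D m (m - k)).

Definition act f S D m k : option 'I_N :=
  f (decisions f S D m (m - k)) (reports f S D m k).

Lemma nth_decisions f S D m n j : (j < n <= m)%N ->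
  nth None (decisions f S D m n) j = act f S D m (m - j).
Proof.
elim: n => [|n IH]; first by rewrite ltn0.
rewrite ltnS /= => /andP[jn nm]; rewrite nth_rcons size_decisions.
case: ltngtP jn => // [jn _|-> _]; first by rewrite IH// jn ltnW.
by rewrite /act /reports subKn// ltnW.
Qed.

(* Delays matter through the arrival times only, and bits once they have
   arrived. *)
Lemma eq_arrived S D S' D' m k ds :
  (forall j i, (j < size ds)%N -> nth None ds j = Some i ->
     (m - j - D i (m - j) = m - j - D' i (m - j))%N /\
     ((k < m - j - D i (m - j))%N -> S i (m - j)%N = S' i (m - j)%N)) ->
  arrived S' D' m k ds = arrived S D m k ds.
Proof.
move=> h; rewrite /arrived.
have : all (fun j => j < size ds)%N (iota 0 (size ds)).
  by apply/allP => j; rewrite mem_iota.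
elim: iota => [//|j s IH] /= /andP[jds js]; rewrite IH//.
case E : (nth None ds j) => [i|//]; have [e1 e2] := h _ _ jds E.
by rewrite -e1; case: ifP => // /e2 ->.
Qed.

(** These decisions are taken before slot [k], so they use only bits that have also arrived by slot
    [k]. *)
Lemma eq_decisions f S D S' D' m k n : (n <= m - k)%N ->
  (forall j i, (j < n)%N -> act f S D m (m - j) = Some i ->
     (m - j - D i (m - j) = m - j - D' i (m - j))%N /\
     ((k < m - j - D i (m - j))%N -> S i (m - j)%N = S' i (m - j)%N)) ->
  decisions f S' D' m n = decisions f S D m n.
Proof.
elim: n => [//|n IH] nmk h; have nm : (n <= m)%N by lia.
have E : decisions f S' D' m n = decisions f S D m n.
  by apply: IH => [|j i jn]; [exact: ltnW|apply: h; exact: ltnW].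
rewrite /= E; congr (rcons _ (f _ _)); apply: eq_arrived => j i.
rewrite size_decisions => jn; rewrite nth_decisions ?jn// => /(h _ _ (ltnW jn))[e1 e2].
by split=> // lt; apply: e2; lia.
Qed.

Lemma eq_reports f S D S' D' m k : (k <= m)%N ->
  (forall j i, (j < m - k)%N -> act f S D m (m - j) = Some i ->
     (m - j - D i (m - j) = m - j - D' i (m - j))%N /\
     ((k < m - j - D i (m - j))%N -> S i (m - j)%N = S' i (m - j)%N)) ->
  reports f S' D' m k = reports f S D m k.
Proof.
move=> km h; rewrite /reports (eq_decisions (leqnn _) h).
apply: eq_arrived => j i; rewrite size_decisions => jn.
by rewrite nth_decisions ?jn ?leq_subr//; exact: h.
Qed.

Lemma eq_act f S D S' D' m k : (k <= m)%N ->
  (forall j i, (j < m - k)%N -> act f S D m (m - j) = Some i ->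
     (m - j - D i (m - j) = m - j - D' i (m - j))%N /\
     ((k < m - j - D i (m - j))%N -> S i (m - j)%N = S' i (m - j)%N)) ->
  act f S' D' m k = act f S D m k.
Proof.
by move=> km h; rewrite /act (eq_decisions (leqnn _) h) (eq_reports km h).
Qed.

Lemma eq_act_above f S D S' D' m k : (k <= m)%N ->
  (forall i t, (k < t <= m)%N -> S i t = S' i t) ->
  (forall i t, (k < t <= m)%N -> D i t = D' i t) ->
  act f S' D' m k = act f S D m k.
Proof.
by move=> km hS hD; apply: eq_act => // j i jmk _; rewrite hS ?hD//; lia.
Qed.

Lemma mem_arrived S D m k ds t i b a : (t, i, b, a) \in arrived S D m k ds ->
  b = S i t.
Proof.
rewrite /arrived mem_pmap => /mapP[j _].
by case: nth => // i'; case: ifP => // _ [-> -> -> _].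
Qed.

Lemma arrived_mem S D m k ds j i : (j < size ds)%N -> nth None ds j = Some i ->
  (k < m - j - D i (m - j))%N ->
  ((m - j)%N, i, S i (m - j)%N, (m - j - D i (m - j))%N) \in arrived S D m k ds.
Proof.
move=> jds dsj lt; rewrite /arrived mem_pmap; apply/mapP; exists j.
  by rewrite mem_iota.
by rewrite dsj lt.
Qed.

(* The channel states enter the feedback only through the bits it displays:
   once these are right, the delays and the rule can be exchanged. *)
Lemma reports_cross f f' S D S' D' m k : (k <= m)%N ->
  reports f S D m k = reports f' S' D' m k ->
  reports f' S D' m k = reports f' S' D' m k /\
  act f' S D' m k = act f' S' D' m k.
Proof.
move=> km e.
suff h j i : (j < m - k)%N -> act f' S' D' m (m - j) = Some i ->
    (m - j - D' i (m - j) = m - j - D' i (m - j))%N /\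
    ((k < m - j - D' i (m - j))%N -> S' i (m - j)%N = S i (m - j)%N).
  by split; [exact: eq_reports|exact: eq_act].
move=> jmk a; split=> // lt.
(* A report displayed under [S'] also belongs to the feedback generated under [S], which forces its
   bit to be that of [S]. *)
have : ((m - j)%N, i, S' i (m - j)%N, (m - j - D' i (m - j))%N)
    \in reports f S D m k.
  rewrite e; apply: arrived_mem => //; first by rewrite size_decisions.
  by rewrite nth_decisions ?jmk ?leq_subr.
exact: mem_arrived.
Qed.

End decisions_theory.

(** * The most recent report *)

Section latest_feedback.
Context (R : realType) (p r : R).
Context (N m M : nat) (w : 'I_M -> R).

Local Notation ps := (stat_on p r).
Local Notation T := (evolve p r).

(** Delays range over a finite type here, so that means are finite sums; [w] will be the law of the
    delay capped at the horizon. *)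
Definition delay_kernel (y : nat -> {ffun 'I_N -> 'I_M}) (t : nat)
  (a : {ffun 'I_N -> 'I_M}) : R := \prod_i w (a i).

Context (x0 : nat -> {ffun 'I_N -> bool}) (y0 : nat -> {ffun 'I_N -> 'I_M}).

(** The slots 1 to [m] are averaged over; [x0] and [y0] merely supply values in the other slots. *)
Definition mean (F : (nat -> {ffun 'I_N -> bool}) ->
    (nat -> {ffun 'I_N -> 'I_M}) -> R) : R :=
  sweep (chan_kernel p r m) m (fun x => sweep delay_kernel m (F x) y0) x0.

Lemma meanC F : mean F =
  sweep delay_kernel m (fun y => sweep (chan_kernel p r m) m (F^~ y) x0) y0.
Proof. exact: sweep_swap. Qed.

Lemma eq_mean F G : (forall x y, F x y = G x y) -> mean F = mean G.
Proof. by move=> FG; apply: eq_sweep => x _; apply: eq_sweep => y _. Qed.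

Lemma mean_sum (I : Type) (s : seq I) (P : pred I) F :
  mean (fun x y => \sum_(i <- s | P i) F i x y) =
  \sum_(i <- s | P i) mean (F i).
Proof.
by rewrite /mean -sweep_sum; apply: eq_sweep => x _; rewrite sweep_sum.
Qed.

Lemma meanD F G : mean (fun x y => F x y + G x y) = mean F + mean G.
Proof. by rewrite /mean -sweepD; apply: eq_sweep => x _; rewrite sweepD. Qed.

Lemma meanZ c F : mean (fun x y => c * F x y) = c * mean F.
Proof. by rewrite /mean -sweepZ; apply: eq_sweep => x _; rewrite sweepZ. Qed.

Lemma mean0 F : (forall x y, F x y = 0) -> mean F = 0.
Proof.
move=> F0; transitivity (mean (fun x y => 0 * F x y)).
  by apply: eq_mean => x y; rewrite F0 mul0r.
by rewrite meanZ mul0r.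
Qed.

(** If the mean of [G] over the delays is the same for every channel trajectory, it factors out,
    even though [G] itself may depend on the channels. *)
Lemma mean_chan (F : (nat -> {ffun 'I_N -> bool}) -> R) G c :
  (forall x, sweep delay_kernel m (G x) y0 = c) ->
  mean (fun x y => F x * G x y) = c * sweep (chan_kernel p r m) m F x0.
Proof.
move=> Gc; rewrite /mean -sweepZ; apply: eq_sweep => x _.
by rewrite sweepZ Gc mulrC.
Qed.

Definition curry_chan (x : nat -> {ffun 'I_N -> bool}) : 'I_N -> nat -> bool :=
  fun i t => x t i.
Definition curry_delay (y : nat -> {ffun 'I_N -> 'I_M}) : 'I_N -> nat -> nat :=
  fun i t => y t i.

Context (f : seq (option 'I_N) -> seq (report N) -> option 'I_N).
Context (k : nat) (k0 : (0 < k)%N) (km : (k <= m)%N) (i0 : 'I_N).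
Implicit Types (x : nat -> {ffun 'I_N -> bool})
  (y : nat -> {ffun 'I_N -> 'I_M}).

Local Notation a x y := (act f (curry_chan x) (curry_delay y) m).

(* An idle slot gets a dummy user, so that a delay is met in every slot. *)
Definition sched (t : nat) x y : 'I_N := odflt i0 (a x y t).

(* the feedback of slot k + d + 1 is available in slot k *)
Definition heard (d : nat) x y : bool :=
  (y (k + d).+1 (sched (k + d).+1 x y) <= d)%N.

Definition silent (l : nat) x y : bool := [forall d : 'I_l, ~~ heard d x y].

Definition latest (l : nat) x y : bool := heard l x y && silent l x y.

Lemma silentS l x y : silent l.+1 x y = silent l x y && ~~ heard l x y.
Proof.
apply/forallP/andP => [h|[/forallP h hl] [d dl] /=].
  by split; [apply/forallP => d; exact: (h (widen_ord (leqnSn l) d))|exact: (h ord_max)].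
have [->//|ne] := eqVneq d l; have dl' : (d < l)%N by rewrite ltn_neqAle ne.
exact: (h (Ordinal dl')).
Qed.

(** Looking back from slot [k], either there is a first heard slot among the [n] preceding ones, or
    all of them are silent. *)
Lemma sum_latest n x y :
  \sum_(l < n) (latest l x y)%:R + (silent n x y)%:R = 1 :> R.
Proof.
elim: n => [|n IH].
  by rewrite big_ord0 add0r; case: (boolP (silent _ _ _)) => // /forallPn[[]].
rewrite big_ord_recr/= -[RHS]IH -addrA; congr (_ + _).
by rewrite silentS /latest; case: heard; case: silent; rewrite /= ?addr0 ?add0r.
Qed.

Lemma prod_silent n x y :
  (silent n x y)%:R = \prod_(d < n) (~~ heard d x y)%:R :> R.
Proof.
elim: n => [|n IH].
  by rewrite big_ord0; case: (boolP (silent _ _ _)) => // /forallPn[[]].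
by rewrite big_ord_recr/= -IH silentS -natrM mulnb.
Qed.

Lemma sched_above t x y x' y' : (t <= m)%N ->
  agree_above t x x' -> agree_above t y y' -> sched t x y = sched t x' y'.
Proof.
move=> tm xx yy; rewrite /sched; congr odflt; apply/esym/eq_act_above => // i s.
  by move=> /andP[ts _]; rewrite /curry_chan xx.
by move=> /andP[ts _]; rewrite /curry_delay yy.
Qed.

(* As long as no report from the slots after slot k + l + 1 has arrived, the
   channel states there do not influence the decisions. *)
Lemma silent_act l x x' y t : (k + l <= m)%N -> (k <= t <= m)%N ->
  agree_above (k + l) x x' -> silent l x y -> a x' y t = a x y t.
Proof.
move=> klm /andP[kt tm] xx /forallP sil; apply: eq_act => // j i jmt e; split=> // lt.
rewrite /curry_chan; case: (ltnP (k + l) (m - j)) => [|le]; first by move/xx ->.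
(* The slot [m - j] is now among the unheard ones, so its report cannot have arrived in time. *)
have ltl : (m - j - k.+1 < l)%N by lia.
have := sil (Ordinal ltl); rewrite /heard /sched /= (_ : (k + _).+1 = m - j)%N; last by lia.
by rewrite e /= -ltnNge; move: lt; rewrite /curry_delay; lia.
Qed.

(** During silence the users scheduled, hence the delays read, are the same for both channel
    trajectories. *)
Lemma silent_agree l x x' y : (k + l <= m)%N -> agree_above (k + l) x x' ->
  silent l x y = silent l x' y.
Proof.
move=> klm xx; suff hs z z' : agree_above (k + l) z z' -> silent l z y -> silent l z' y.
  by apply/idP/idP; apply: hs => // t lt; rewrite xx.
move=> zz sil; apply/forallP => -[d dl] /=.
have := forallP sil (Ordinal dl); rewrite /heard /sched /=.
by rewrite (silent_act _ _ zz sil)//; lia.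
Qed.

Lemma latest_agree l x x' y : (k + l < m)%N -> agree_above (k + l) x x' ->
  latest l x y = latest l x' y.
Proof.
move=> klm xx; rewrite /latest (silent_agree _ (ltnW klm) xx) /heard.
congr ((nat_of_ord (y _ _) <= _)%N && _).
by apply: sched_above => // t lt; apply: xx; exact: ltnW.
Qed.

Lemma big_nat_window n (F : nat -> R) : (k + n <= m)%N ->
  (forall t, (t <= k)%N || (k + n < t)%N -> F t = 1) ->
  \prod_(1 <= t < m.+1) F t = \prod_(d < n) F (k + d).+1.
Proof.
move=> knm F1; rewrite (big_cat_nat (n := k.+1))//= big_nat_cond big1 ?mul1r; last first.
  by move=> t /andP[/andP[_ tk] _]; rewrite F1 // -ltnS tk.
rewrite (big_cat_nat (n := (k + n).+1))//=; try by lia.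
rewrite [X in _ * X]big_nat_cond [X in _ * X]big1 ?mulr1; last first.
  by move=> t /andP[/andP[kt _] _]; rewrite F1// kt orbT.
rewrite -(big_mkord xpredT (fun d => F (k + d).+1)) -{1}[k.+1]add0n big_addn.
rewrite subSS addKn; apply: eq_bigr => d _; by rewrite addnS addnC.
Qed.

Hypotheses (hp : 0 <= p <= 1) (hr : 0 <= r <= 1) (hpr : r < p)
  (hnd : p + (1 - r) < 2).
Hypotheses (w0 : forall b, 0 <= w b) (w1 : \sum_b w b = 1).

Lemma delay_is_kernel : is_kernel delay_kernel.
Proof.
split=> y t => [a|]; first exact: prodr_ge0.
by rewrite (sum_ffun_prod (fun=> w)) big1.
Qed.

Lemma ler_mean F G : (forall x y, F x y <= G x y) -> mean F <= mean G.
Proof.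
move=> FG; apply: ler_sweep => [|x _]; first exact: chan_is_kernel.
by apply: ler_sweep => [|y _]; first exact: delay_is_kernel.
Qed.

(** * Law of the age of the most recent report, and the mean gain *)

Definition heard_prob (d : nat) : R := \sum_b w b * (b <= d)%N%:R.
Definition unheard_prob (d : nat) : R := \sum_b w b * (d < b)%N%:R.

Definition silent_prob (n : nat) : R := \prod_(0 <= d < n) unheard_prob d.

(** Each user is chosen from earlier slots alone, so the delays read are independent with law [w],
    whatever the channel trajectory [x] is. *)
Lemma sweep_silent n x : (k + n <= m)%N ->
  sweep delay_kernel m (fun y => (silent n x y)%:R) y0 = silent_prob n.
Proof.
move=> knm.
(* [h t] tests that the report of slot [t] misses slot [k], that is, that its delay exceeds
   [t - k - 1]; outside the window it is 1. *)
pose h t (b : 'I_M) : R :=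
  if (k < t <= k + n)%N then (t - k.+1 < b)%N%:R else 1.
pose c t y := if (t <= m)%N then sched t x y else i0.
have h1 t b : (t <= k)%N || (k + n < t)%N -> h t b = 1.
  by move=> ?; rewrite /h ifF//; lia.
have hE (d : 'I_n) b : h (k + d).+1 b = (d < b)%N%:R.
  by rewrite /h ifT ?subSS ?addKn//; have := ltn_ord d; lia.
have cE (d : 'I_n) y : c (k + d).+1 y = sched (k + d).+1 x y.
  by rewrite /c ifT//; have := ltn_ord d; lia.
transitivity (sweep delay_kernel m
    (fun y => \prod_(1 <= t < m.+1) h t (y t (c t y))) y0).
  apply: eq_sweep => y _; rewrite (big_nat_window knm); last by move=> t /h1.
  by rewrite prod_silent; apply: eq_bigr => d _; rewrite hE cE -ltnNge.
rewrite (sweep_prod_adapted (w := w))//; last first.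
  by move=> t y y' yy; rewrite /c; case: ifP => // tm; exact: sched_above.
rewrite (big_nat_window (n := n))//; last first.
  by move=> t /h1 ht; under eq_bigr do rewrite ht mulr1.
rewrite /silent_prob big_mkord; apply: eq_bigr => d _.
by apply: eq_bigr => b _; rewrite hE.
Qed.

(** The report of age [l + 1] is the latest iff silence lasts for [l] but not for [l + 1] slots, so
    its probability is a difference of two silence probabilities. *)
Lemma sweep_latest l x : (k + l < m)%N ->
  sweep delay_kernel m (fun y => (latest l x y)%:R) y0 =
  heard_prob l * silent_prob l.
Proof.
move=> klm; have -> : heard_prob l = 1 - unheard_prob l.
  apply/eqP; rewrite eq_sym subr_eq -w1 -big_split/=; apply/eqP.
  by apply: eq_bigr => b _; rewrite -mulrDr ltnNge; case: leqP; rewrite /= ?addr0 ?add0r mulr1.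
rewrite mulrBl mul1r; apply/eqP; rewrite eq_sym subr_eq; apply/eqP.
have -> : unheard_prob l * silent_prob l = silent_prob l.+1.
  by rewrite /silent_prob big_nat_recr//= mulrC.
rewrite -(sweep_silent x (ltnW klm)).
rewrite -(@sweep_silent l.+1 x) ?addnS// -sweepD; apply: eq_sweep => y _.
by rewrite silentS /latest; case: silent; case: heard; rewrite /= ?addr0 ?add0r.
Qed.

(* The last term accounts for the slots reached before any report arrives. *)
Definition epoch_gain (V : {set 'I_N}) (n : nat) : R :=
  \sum_(l < n) genie_mean p r #|V| l * (heard_prob l * silent_prob l) +
  silent_prob n * ps.

Definition hit (V : {set 'I_N}) x y : R :=
  \sum_(i in V) (a x y k == Some i)%:R * (x k i)%:R.

Definition served (V : {set 'I_N}) x y : R := \sum_(i in V) (a x y k == Some i)%:R.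

(** Split by the age of the latest report: on each piece the served channel is predicted from the
    reported slot, and without any report its mean is the stationary [ps]. *)
Lemma mean_hit V : mean (hit V) =
  \sum_(l < m - k) mean (fun x y => (latest l x y)%:R *
     \sum_(i in V) (a x y k == Some i)%:R * iter l.+1 T (x (k + l).+1 i)%:R) +
  mean (fun x y => (silent (m - k) x y)%:R * (served V x y * ps)).
Proof.
transitivity (mean (fun x y =>
    \sum_(l < m - k) (latest l x y)%:R * hit V x y +
    (silent (m - k) x y)%:R * hit V x y)).
  by apply: eq_mean => x y; rewrite -mulr_suml -mulrDl sum_latest mul1r.
rewrite meanD mean_sum; congr (_ + _).
  apply: eq_bigr => l _; have klm : (k + l < m)%N by have := ltn_ord l; lia.
  rewrite !meanC; apply: eq_sweep => y _; under eq_sweep do rewrite mulr_sumr.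
  under [RHS]eq_sweep do rewrite mulr_sumr.
  rewrite !sweep_sum; apply: eq_bigr => i _.
  under eq_sweep do rewrite mulrA; under [RHS]eq_sweep do rewrite mulrA.
  (* With the delays fixed, event and decision are functions of the channel up to slot [k + l + 1]
     in time; off the event the weight is 0. *)
  apply: chan_predict => // x x' xx; rewrite (latest_agree _ klm xx).
  have [lx|/negbTE] := boolP (latest l x y); last first.
    by rewrite -(latest_agree _ klm xx) => ->; rewrite !mul0r.
  rewrite (silent_act (ltnW klm) _ xx)//; first by rewrite leqnn.
  by case/andP: lx.
rewrite !meanC; apply: eq_sweep => y _; rewrite /served.
under eq_sweep do rewrite mulr_sumr; under [RHS]eq_sweep do rewrite mulr_suml mulr_sumr.
rewrite !sweep_sum; apply: eq_bigr => i _.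
(* Without any report the decision is determined by the delays alone, so it is a constant in the
   average over the channels. *)
pose c : R := (silent (m - k) x0 y)%:R * (a x0 y k == Some i)%:R.
have cE x : agree_above m x x0 ->
    (silent (m - k) x y)%:R * (a x y k == Some i)%:R = c.
  move=> xx; have xx' : agree_above (k + (m - k)) x x0 by rewrite subnKC.
  have kk : (k + (m - k) <= m)%N by rewrite subnKC.
  rewrite /c -(silent_agree _ kk xx').
  have [sil|] := boolP (silent (m - k) x y); last by rewrite !mul0r.
  by rewrite (silent_act kk _ xx' sil)// leqnn.
rewrite [RHS](sweep_cst (chan_is_kernel hp hr hnd _ _) (c := c * ps))//; last first.
  by move=> x xx; rewrite mulrA cE.
rewrite -(chan_stationary hp hr hpr hnd i c x0 (k := k) (m := m)) ?k0//.
by apply: eq_sweep => x xx; rewrite mulrA cE.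
Qed.

Lemma mean_latest_gain V (l : 'I_(m - k)) :
  mean (fun x y => genie_gain p r V l (x (k + l).+1) * (latest l x y)%:R) =
  genie_mean p r #|V| l * (heard_prob l * silent_prob l).
Proof.
have klm : (k + l < m)%N by have := ltn_ord l; lia.
rewrite (mean_chan (fun x => genie_gain p r V l (x (k + l).+1))
  (G := fun x y => (latest l x y)%:R) (c := heard_prob l * silent_prob l)); last first.
  by move=> x; exact: sweep_latest.
by rewrite mulrC mean_genie_gain.
Qed.

Lemma mean_silent n c : (k + n <= m)%N ->
  mean (fun x y => (silent n x y)%:R * c) = silent_prob n * c.
Proof.
move=> knm; transitivity (mean (fun x y => c * (silent n x y)%:R)).
  by apply: eq_mean => x y; rewrite mulrC.
rewrite (mean_chan (fun=> c) (G := fun x y => (silent n x y)%:R)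
  (c := silent_prob n)); last by move=> x; exact: sweep_silent.
by rewrite (sweep_cst (chan_is_kernel hp hr hnd _ _) (c := c)).
Qed.

Lemma sum_act (V : {set 'I_N}) x y (F : 'I_N -> R) :
  \sum_(i in V) (a x y k == Some i)%:R * F i =
  if a x y k is Some i then if i \in V then F i else 0 else 0.
Proof.
case: (a x y k) => [i|]; last by rewrite big1// => i _; rewrite mul0r.
case: ifPn => [iV|iV].
  rewrite (bigD1 i)//= eqxx mul1r big1 ?addr0// => j /andP[_ ji].
  by rewrite eqE /= eq_sym (negbTE ji) mul0r.
rewrite big1// => j jV; rewrite eqE /=; case: eqP => [ij|]; last by rewrite mul0r.
by rewrite ij jV in iV.
Qed.

(** At most one user is served, and [genie_gain] dominates the predicted state of each user of
    [V]. *)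
Lemma mean_hit_le V : mean (hit V) <= epoch_gain V (m - k).
Proof.
rewrite mean_hit; apply: lerD; last first.
  rewrite -mean_silent ?subnKC//; apply: ler_mean => x y.
  rewrite ler_wpM2l// ler_piMl ?stat_on_ge0// /served.
  have := sum_act V x y (fun=> 1); under eq_bigr do rewrite mulr1; move=> ->.
  by case: (a x y k) => // i; case: ifP.
apply: ler_sum => l _; rewrite -mean_latest_gain; apply: ler_mean => x y.
rewrite [leRHS]mulrC ler_wpM2l// sum_act.
have g0 : 0 <= genie_gain p r V l (x (k + l).+1).
  have /andP[? _] := iter_evolve01 hp hr hpr l hp.
  have /andP[? _] := iter_evolve01 hp hr hpr l hr.
  by rewrite /genie_gain; case: ifP.
by case: (a x y k) => // i; case: ifP => // iV; exact: genie_gain_ge.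
Qed.

(** Equality case of [mean_hit_le]: the prediction for the served user is exactly the genie's, and
    no slot is lost before the first report. *)
Lemma mean_hit_eq (V : {set 'I_N}) :
  (forall (l : 'I_(m - k)) x y, latest l x y -> exists2 i, i \in V &
    a x y k = Some i /\ x (k + l).+1 i = [exists j in V, x (k + l).+1 j]) ->
  (forall x y, silent (m - k) x y -> exists2 i, i \in V & a x y k = Some i) ->
  mean (hit V) = epoch_gain V (m - k).
Proof.
move=> hl hs; rewrite mean_hit; congr (_ + _); last first.
  rewrite -mean_silent ?subnKC//; apply: eq_mean => x y.
  have [/hs[i iV e]|_] := boolP (silent _ x y); last by rewrite !mul0r.
  rewrite /served; have := sum_act V x y (fun=> 1); under eq_bigr do rewrite mulr1.
  by move=> ->; rewrite e iV [in LHS]mul1r.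
apply: eq_bigr => l _; rewrite -mean_latest_gain; apply: eq_mean => x y.
have [/hl[i iV [e xi]]|_] := boolP (latest _ x y); last by rewrite mul0r mulr0.
rewrite mulrC; congr (_ * _); rewrite sum_act e iV iterSr evolve_bool xi /genie_gain.
by case: ifP.
Qed.

End latest_feedback.

(** * The greedy policy on two users *)

(** Change of variables by [h] in each averaged slot. *)
Lemma sweep_equivariant (R : realType) (T : finType)
    (K : (nat -> T) -> nat -> T -> R) (h : T -> T) t F x :
  involutive h -> (forall y s a, K (h \o y) s (h a) = K y s a) ->
  sweep K t F (h \o x) = sweep K t (fun y => F (h \o y)) x.
Proof.
move=> hh hK; elim: t x => [//|t IH] x /=.
rewrite (reindex_inj (inv_inj hh)) /=; apply: eq_bigr => a _.
rewrite hK -IH; congr (_ * sweep _ _ _ _); apply/funext => s.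
by rewrite /set_slot /=; case: eqP.
Qed.

Section two_users.
Context (N : nat) (j k : 'I_N).
Implicit Types (S : 'I_N -> nat -> bool) (D : 'I_N -> nat -> nat).

Local Notation swap := (tperm j k).
Local Notation V := [set j; k]%SET.

(** Feedback is listed by originating slot, oldest first, so the head of [rev fb] is the freshest
    report, not the last to arrive. The user [c] is served until a report is available. *)
Definition greedy (c : 'I_N) (ds : seq (option 'I_N)) (fb : seq (report N)) :
    option 'I_N :=
  Some (if rev fb is (_, i, b, _) :: _ then if b then i else swap i else c).

(** A report names a user scheduled before, which lies in [V] by induction, and [swap] preserves
    [V]. *)
Lemma greedy_decisions c S D m n : c \in V ->
  all (fun d => if d is Some i then i \in V else false)
    (decisions (greedy c) S D m n).
Proof.
move=> cV; elim: n => [//|n IH] /=; set ds := decisions _ _ _ _ _ in IH *.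
rewrite all_rcons IH andbT /greedy.
case E : (rev _) => [|[[[t i] b] a] s] //.
have : (t, i, b, a) \in arrived S D m (m - n) ds by rewrite -mem_rev E inE eqxx.
rewrite /arrived mem_pmap => /mapP[q]; rewrite mem_iota => /= qds.
case Eq : (nth None ds q) => [i'|//]; case: ifP => // _ [_ ii' _ _].
have := all_nthP None IH q qds; rewrite Eq -ii' => iV.
by case: (b) => //; case: tpermP iV => // _ _; rewrite !inE eqxx ?orbT.
Qed.

Lemma greedy_act c S D m t : c \in V -> (t <= m)%N ->
  exists2 i, i \in V & act (greedy c) S D m t = Some i.
Proof.
move=> cV tm; have := greedy_decisions S D m (m - t).+1 cV.
rewrite /= all_rcons => /andP[+ _]; rewrite /act /reports subKn//.
by move=> iV; eexists; first exact: iV.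
Qed.

(** * Symmetry of the greedy policy under exchange of the two users *)

Definition swap_report (x : report N) : report N :=
  let: (t, i, b, a) := x in (t, swap i, b, a).

Lemma arrived_swap S D m s ds :
  arrived (fun i => S (swap i)) (fun i => D (swap i)) m s (map (omap swap) ds) =
  map swap_report (arrived S D m s ds).
Proof.
rewrite /arrived size_map.
have : all (fun q => q < size ds)%N (iota 0 (size ds)).
  by apply/allP => q; rewrite mem_iota.
elim: iota => [//|q u IH] /= /andP[qds us]; rewrite IH// (nth_map None)//.
by case: (nth None ds q) => [i|] //=; rewrite tpermK; case: ifP.
Qed.

Lemma greedy_swap c ds ds' fb :
  greedy (swap c) ds (map swap_report fb) = omap swap (greedy c ds' fb).
Proof.
rewrite /greedy -map_rev; case: (rev fb) => [//|[[[t i] b] a] s] /=.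
by case: b.
Qed.

Lemma decisions_swap c S D m n :
  decisions (greedy (swap c)) (fun i => S (swap i)) (fun i => D (swap i)) m n =
  map (omap swap) (decisions (greedy c) S D m n).
Proof.
elim: n => [//|n IH] /=; rewrite IH map_rcons; congr rcons.
by rewrite arrived_swap; exact: greedy_swap.
Qed.

Lemma act_swap c S D m t :
  act (greedy (swap c)) (fun i => S (swap i)) (fun i => D (swap i)) m t =
  omap swap (act (greedy c) S D m t).
Proof.
by rewrite /act /reports decisions_swap arrived_swap; exact: greedy_swap.
Qed.

Context (R : realType) (p r : R).
Context (m M : nat) (w : 'I_M.+1 -> R).

Definition user_hit (f : seq (option 'I_N) -> seq (report N) -> option 'I_N)
    (t : nat) (i : 'I_N) : R :=
  mean p r m w (fun=> [ffun=> false]) (fun=> [ffun=> ord0])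
    (fun x y => (act f (curry_chan x) (curry_delay y) m t == Some i)%:R * (x t i)%:R).

Lemma user_hit_swap c t i :
  user_hit (greedy c) t i = user_hit (greedy (swap c)) t (swap i).
Proof.
pose h (T : Type) (a : {ffun 'I_N -> T}) : {ffun 'I_N -> T} :=
  [ffun u => a (swap u)].
have hh T : involutive (h T) by move=> a; apply/ffunP => u; rewrite !ffunE tpermK.
(* The constant initial trajectories are invariant under the exchange, so they can be put in the
   form required by [sweep_equivariant]. *)
have hc T (c0 : T) : (fun _ : nat => [ffun=> c0]) = h T \o (fun=> [ffun=> c0]).
  by apply/funext => s; apply/ffunP => u; rewrite !ffunE.
rewrite /user_hit /mean {1}(hc _ false) {1}(hc _ ord0).
rewrite (sweep_equivariant _ _ _ (hh _)).
  apply: eq_sweep => x _; rewrite (sweep_equivariant _ _ _ (hh _)).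
    apply: eq_sweep => y _ /=; rewrite ffunE; congr ((nat_of_bool _)%:R * _).
    have -> : curry_chan (h bool \o x) = fun u => curry_chan x (swap u).
      by apply/funext => u; apply/funext => s; rewrite /curry_chan /= ffunE.
    have -> : curry_delay (h _ \o y) = fun u => curry_delay y (swap u).
      by apply/funext => u; apply/funext => s; rewrite /curry_delay /= ffunE.
    rewrite -{1}[c](tpermK j k) act_swap.
    case: act => [u|] //=; by rewrite !eqE /= (can2_eq (tpermK j k) (tpermK j k)).
  move=> y s a; rewrite /delay_kernel (reindex_inj (@perm_inj _ swap)) /=.
  by apply: eq_bigr => u _; rewrite ffunE tpermK.
move=> y s a; rewrite /chan_kernel (reindex_inj (@perm_inj _ swap)) /=.
by apply: eq_bigr => u _; rewrite /user_kernel /= !ffunE tpermK.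
Qed.

(** The bit of the latest report decides between [u] and the other user: if [u] was OFF, only the
    other one can have been ON. *)
Lemma greedy_latest c t l (x : nat -> {ffun 'I_N -> bool})
    (y : nat -> {ffun 'I_N -> 'I_M.+1}) : c \in V -> (t <= m)%N -> (l < m - t)%N ->
  latest m (greedy c) t j l x y ->
  exists2 i, i \in V &
    act (greedy c) (curry_chan x) (curry_delay y) m t = Some i /\
    x (t + l).+1 i = [exists u in V, x (t + l).+1 u].
Proof.
move=> cV tm ltl /andP[hl /forallP sil].
set S := curry_chan x; set D := curry_delay y.
have sc d : (d <= l)%N -> exists2 u, u \in V & act (greedy c) S D m (t + d).+1 = Some u /\
    heard m (greedy c) t j d x y = (D u (t + d).+1 <= d)%N.
  move=> dl; have tdm : ((t + d).+1 <= m)%N by lia.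
  have [u uV au] := greedy_act S D cV tdm; exists u => //.
  by split=> //; rewrite /heard /sched au.
have [u uV [au hu]] := sc l (leqnn l).
(* The position of slot [t + l + 1] in the list of past decisions; the entries after it are silent
   and add nothing to the feedback. *)
pose q := (m - t - l.+1)%N.
have [s rs] : exists s, reports (greedy c) S D m t =
    rcons s ((t + l).+1, u, x (t + l).+1 u, ((t + l).+1 - D u (t + l).+1)%N).
  rewrite /reports /arrived size_decisions.
  have -> : iota 0 (m - t) = iota 0 (q + (1 + l)) by congr iota; rewrite /q; lia.
  rewrite iotaD pmap_cat add0n iotaD pmap_cat /=.
  have -> : (m - q = (t + l).+1)%N by rewrite /q; lia.
  rewrite nth_decisions; last by rewrite /q; lia.
  have -> : (m - q = (t + l).+1)%N by rewrite /q; lia.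
  rewrite au ifT; last by move: hl; rewrite hu; lia.
  eexists; rewrite -cats1; congr (_ ++ _); rewrite /= [pmap _ _](_ : _ = [::])//.
  have : all (fun i => q < i < m - t)%N (iota (q + 1) l).
    by apply/allP => i; rewrite mem_iota /q; lia.
  elim: iota => [//|i e IH] /= /andP[iq ie]; rewrite IH//.
  rewrite nth_decisions; last by rewrite /q in iq *; lia.
  have dl : (m - t - i.+1 < l)%N by rewrite /q in iq *; lia.
  have [v vV] := sc _ (ltnW dl).
  have -> : (t + (m - t - i.+1)).+1 = (m - i)%N by rewrite /q in iq *; lia.
  move=> [-> hv]; rewrite ifF//; have := sil (Ordinal dl); rewrite /= hv.
  by rewrite /q in iq *; lia.
have uk : swap u \in V by case: tpermP uV => // _ _; rewrite !inE eqxx ?orbT.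
exists (if x (t + l).+1 u then u else swap u); first by case: ifP.
split; first by rewrite /act rs /greedy rev_rcons.
apply/esym; case: ifPn => xu; first by rewrite xu; apply/existsP; exists u; rewrite uV.
apply/existsP/idP => [[v /andP[vV xv]]|xs]; last by exists (swap u); rewrite uk.
have [vu|vu] := eqVneq v u; first by rewrite -vu xv in xu.
suff <- : v = swap u by [].
by move: vV uV vu; rewrite !inE => /orP[]/eqP-> /orP[]/eqP-> ; rewrite ?eqxx// ?tpermL ?tpermR.
Qed.

Hypotheses (hp : 0 <= p <= 1) (hr : 0 <= r <= 1) (hpr : r < p)
  (hnd : p + (1 - r) < 2).
Hypotheses (w0 : forall b, 0 <= w b) (w1 : \sum_b w b = 1).

(** This fixes only the sum of the two rates; the split between the users may depend on the starting
    user. *)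
Lemma user_hit_greedy c t : j != k -> c \in V -> (0 < t <= m)%N ->
  user_hit (greedy c) t j + user_hit (greedy c) t k =
  epoch_gain p r w V (m - t).
Proof.
move=> jk cV /andP[t0 tm].
rewrite -(mean_hit_eq (fun=> [ffun=> false]) (fun=> [ffun=> ord0]) (f := greedy c)
  t0 tm (i0 := j) hp hr hpr hnd w0 w1 (V := V)).
- rewrite /user_hit -meanD; apply: eq_mean => x y.
  rewrite /hit (bigD1 j) ?inE ?eqxx//= (bigD1 k) ?inE ?eqxx ?orbT 1?eq_sym//=.
  by rewrite big1 ?addr0// => i; rewrite !inE => /andP[/andP[]]; case/orP => ->.
- by move=> l x y hl; exact: greedy_latest.
- move=> x y sil; exact: greedy_act.
Qed.

End two_users.

(** * Limits of the per-slot gains *)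

Lemma measure_fin_partition d (X : measurableType d) (R : realType)
    (mu : {measure set X -> \bar R}) (T : finType) (g : X -> T) (A : set X) :
  (forall t, measurable (A `&` [set x | g x = t])) ->
  mu A = (\sum_t mu (A `&` [set x | g x = t]))%E.
Proof.
move=> mA; have -> : A = \bigcup_(t in [set` enum T]) (A `&` [set x | g x = t]).
  apply/seteqP; split => [x Ax|x [t _ []]//]; exists (g x) => //=.
  by rewrite mem_enum.
rewrite measure_fin_bigcup//; last first.
  apply/trivIsetP => t u _ _ /eqP tu; apply/seteqP; split => // x [[_ gt] [_ gu]].
  by case: tu; rewrite -gt.
rewrite -fsbig_seq ?enum_uniq// big_enum/=; apply: eq_bigr => t _.
congr (mu _); apply/seteqP; split => [x [Ax gx]|x [[u _ []]//]].
by split=> //; exists t => //=; rewrite mem_enum.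
Qed.

Lemma fine_fin_partition d (X : measurableType d) (R : realType)
    (P : probability X R) (T : finType) (g : X -> T) (A : set X) :
  (forall t, measurable (A `&` [set x | g x = t])) ->
  fine (P A) = \sum_t fine (P (A `&` [set x | g x = t])).
Proof.
move=> mA; rewrite (measure_fin_partition P mA) -sum_fine// => t _.
by rewrite fin_num_measure.
Qed.

Section capacity_values.
Context (R : realType) (p r : R) (PD : probability nat R).

Local Notation ps := (stat_on p r).

(* A delay of m slots or more is never over before the end of the horizon m. *)
Definition cap (m d : nat) : 'I_m.+1 := inord (minn d m).

Lemma capE m d : cap m d = minn d m :> nat.
Proof. by rewrite inordK// ltnS geq_minr. Qed.

Definition delay_weight (m : nat) (b : 'I_m.+1) : R := fine (PD [set d | cap m d = b]).

Lemma delay_weight_ge0 m b : 0 <= delay_weight (m := m) b.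
Proof. exact: fine_ge0. Qed.

Lemma sum_delay_weightM m (A : pred nat) :
  \sum_(b < m.+1) delay_weight b * (A b)%:R = fine (PD [set d | A (cap m d)]).
Proof.
rewrite (fine_fin_partition PD (g := cap m))//; apply: eq_bigr => b _.
rewrite /delay_weight; case: (boolP (A b)) => Ab; rewrite ?mulr1 ?mulr0.
  congr (fine (PD _)); apply/seteqP; split => [d /= db|d []//].
  by split=> //=; rewrite db.
rewrite [X in PD X](_ : _ = set0) ?measure0//.
by apply/seteqP; split => // d /= [] + db; rewrite db (negbTE Ab).
Qed.

Lemma sum_delay_weight m : \sum_(b < m.+1) delay_weight b = 1.
Proof.
have := sum_delay_weightM m xpredT; under eq_bigr do rewrite mulr1; move=> ->.
rewrite [X in PD X](_ : _ = setT) ?probability_setT//.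
by apply/seteqP; split.
Qed.

Definition late (l : nat) : R := \prod_(0 <= d < l) fine (PD [set d' | (d < d')%N]).

Lemma unheard_probE m d : (d < m)%N ->
  unheard_prob (delay_weight (m := m)) d = fine (PD [set d' | (d < d')%N]).
Proof.
move=> dm; rewrite /unheard_prob (sum_delay_weightM m (fun b => d < b)%N).
congr (fine (PD _)); apply/seteqP; split => d' /=; rewrite capE; lia.
Qed.

Lemma heard_probE m d : (d < m)%N ->
  heard_prob (delay_weight (m := m)) d = fine (PD [set d' | (d' <= d)%N]).
Proof.
move=> dm; rewrite /heard_prob (sum_delay_weightM m (fun b => b <= d)%N).
congr (fine (PD _)); apply/seteqP; split => d' /=; rewrite capE; lia.
Qed.

Lemma silent_probE m n : (n <= m)%N ->
  silent_prob (delay_weight (m := m)) n = late n.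
Proof.
move=> nm; apply: eq_big_nat => d /andP[_ dn].
by rewrite unheard_probE// (leq_trans dn).
Qed.

(** A partial sum of the genie capacity plus the term for silence: [epoch_gain] expressed by the
    true delay law, free of the horizon. *)
Definition gain (c n : nat) : R :=
  series (fun l => genie_mean p r c l * latest_prob PD l) n + late n * ps.

Lemma epoch_gainE (N m n : nat) (V : {set 'I_N}) : (n <= m)%N ->
  epoch_gain p r (delay_weight (m := m)) V n = gain #|V| n.
Proof.
move=> nm; rewrite /epoch_gain /gain /series /= silent_probE// big_mkord.
congr (_ + _); apply: eq_bigr => l _; have lm := leq_trans (ltn_ord l) nm.
by rewrite heard_probE// silent_probE// ltnW.
Qed.

Lemma late_ge0 n : 0 <= late n.
Proof. by apply: prodr_ge0 => d _; exact: fine_ge0. Qed.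

Lemma prob_le1 (A : set nat) : fine (PD A) <= 1.
Proof. by rewrite -lee_fin fineK ?fin_num_measure// probability_le1. Qed.

Lemma late_le1 n : late n <= 1.
Proof.
rewrite /late; elim: n => [|n IH]; first by rewrite big_geq.
by rewrite big_nat_recr//= mulr_ile1// ?late_ge0 ?fine_ge0// prob_le1.
Qed.

Lemma latest_probE l : latest_prob PD l = late l - late l.+1.
Proof.
rewrite /late big_nat_recr//= /latest_prob -/(late l).
suff -> : fine (PD [set d | (d <= l)%N]) = 1 - fine (PD [set d | (l < d)%N]) by ring.
(* Both probabilities are read off the law capped at [l + 1], whose finitely many weights sum to
   1. *)
rewrite -(heard_probE (ltnSn l)) -(unheard_probE (ltnSn l)).
apply/eqP; rewrite eq_sym subr_eq -(sum_delay_weight l.+1) -big_split/=; apply/eqP.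
by apply: eq_bigr => b _; rewrite -mulrDr ltnNge; case: leqP; rewrite /= ?addr0 ?add0r mulr1.
Qed.

Lemma latest_prob_ge0 l : 0 <= latest_prob PD l.
Proof. by rewrite mulr_ge0 ?late_ge0 ?fine_ge0. Qed.

(** The last factor [P(D > n)] tends to 0 since [D] is finite, and the other factors are at most
    1. *)
Lemma cvg_late : late n @[n --> \oo] --> 0.
Proof.
have cv : (fun n => fine (PD [set d | (n < d)%N])) @ \oo --> (0 : R).
  apply: fine_cvg; have <- : PD (\bigcap_n [set d | (n < d)%N]) = (0 : R)%:E.
    rewrite (_ : \bigcap_n _ = set0) ?measure0//.
    by apply/seteqP; split => // d /(_ d I) /=; rewrite ltnn.
  apply: nonincreasing_cvg_mu => //.
    by rewrite (le_lt_trans (probability_le1 _ _))// ltry.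
  by move=> a b ab; apply/subsetPset => d /=; exact: leq_ltn_trans.
rewrite -cvg_shiftS; apply: (squeeze_cvgr _ (@cvg_cst _ _ _ _ _) cv).
apply: nearW => n; rewrite late_ge0/= /late big_nat_recr//=.
by rewrite ler_piMl ?fine_ge0// late_le1.
Qed.

Hypotheses (hp : 0 <= p <= 1) (hr : 0 <= r <= 1) (hpr : r < p)
  (hnd : p + (1 - r) < 2).

(** The terms are nonnegative and dominated by the telescoping differences [late l - late l.+1]. *)
Lemma is_cvg_Csum_genie c :
  cvgn (series (fun l => genie_mean p r c l * latest_prob PD l)).
Proof.
apply: nondecreasing_is_cvgn.
  apply: nondecreasing_series => l _ _.
  have /andP[g0 _] := genie_mean01 hp hr hpr hnd c l.
  by rewrite mulr_ge0// latest_prob_ge0.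
exists 1 => _ [n _ <-]; apply: (@le_trans _ _ (\sum_(0 <= l < n) (late l - late l.+1))).
  apply: ler_sum => l _; rewrite -latest_probE.
  have /andP[_ g1] := genie_mean01 hp hr hpr hnd c l.
  by rewrite ler_piMl ?latest_prob_ge0.
rewrite (telescope_sumr_eq (fun l => - late l))// => [|l _]; last by rewrite opprK addrC.
have l0 : late 0 = 1 by rewrite /late big_geq.
by rewrite l0 opprK; have := late_ge0 n; lra.
Qed.

Lemma cvg_gain c : gain c n @[n --> \oo] --> Csum_genie p r PD c.
Proof.
rewrite -[Csum_genie _ _ _ _]addr0 -(mul0r ps); apply: cvgD.
  exact: is_cvg_Csum_genie.
by apply: cvgM; [exact: cvg_late|exact: cvg_cst].
Qed.

(** [gain] increases to its limit: each step moves the weight [latest_prob] from the value [ps] to a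
    genie mean, which is at least [ps]. *)
Lemma gain_le c n : (0 < c)%N -> gain c n <= Csum_genie p r PD c.
Proof.
move=> c0; have cv := @cvg_gain c; rewrite -(cvg_lim _ cv)//.
apply: nondecreasing_cvgn_le; last exact: cvgP cv.
apply/nondecreasing_seqP => k; rewrite /gain /series /= big_nat_recr//=.
have := ler_wpM2r (latest_prob_ge0 k) (genie_mean_ge hp hr hpr hnd k c0).
by rewrite latest_probE; lra.
Qed.

Lemma Csum_genie_ge0 c : 0 <= Csum_genie p r PD c.
Proof.
apply: limr_ge; first exact: is_cvg_Csum_genie.
apply: nearW => n; apply: sumr_ge0 => l _.
have /andP[g0 _] := genie_mean01 hp hr hpr hnd c l.
by rewrite mulr_ge0// latest_prob_ge0.
Qed.

(** Write [1 - (1 - ps)^2] as [ps + (1 - ps) ps] and use [ps T^l(p) + (1 - ps) T^l(r) = ps]. *)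
Lemma Csum2E : Csum2 p r PD = Csum_genie p r PD 2.
Proof.
rewrite /Csum2 /Csum_genie; congr (limn (series _)); apply/funext => l.
congr (_ * _); have := iter_evolve_stat_conv hnd l.
set a := iter l _ p; set b := iter l _ r => /(congr1 ( *%R (1 - ps))).
by rewrite expr2; lra.
Qed.

Lemma cvg_gain_mean c :
  (\sum_(1 <= k < m.+1) gain c (m - k)) / m%:R @[m --> \oo] --> Csum_genie p r PD c.
Proof.
rewrite -cvg_shiftS; apply: cvg_trans (cesaro (@cvg_gain c)).
apply: near_eq_cvg; apply: nearW => m; rewrite /arithmetic_mean /= mulrC.
congr (_ / _); rewrite /series /= big_add1 /= big_nat_rev/= add0n.
by apply: eq_big_nat => k /andP[_ km]; congr gain; lia.
Qed.

End capacity_values.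

(** * The law of the downlink *)

(** Independence is given for single delay values; countable additivity extends it to sets of
    values, which the cap requires. *)
Lemma nat_fiber_measure d (X : measurableType d) (R : realType)
    (P : probability X R) (PD : probability nat R) (g : X -> nat) (E : set X)
    (c : R) (A : set nat) : 0 <= c ->
  (forall n, measurable (E `&` [set w | g w = n])) ->
  (forall n, P (E `&` [set w | g w = n]) = (c%:E * PD [set n])%E) ->
  measurable (E `&` [set w | A (g w)]) /\
  P (E `&` [set w | A (g w)]) = (c%:E * PD A)%E.
Proof.
move=> c0 mE PE.
have -> : E `&` [set w | A (g w)] = \bigcup_(n in A) (E `&` [set w | g w = n]).
  by apply/seteqP; split => [w [Ew Aw]|w [n An [Ew gw]]]; [exists (g w)|split=> //=; rewrite gw].
split; first by apply: bigcup_measurable => n _; exact: mE.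
rewrite measure_bigcup//; last first.
  apply/trivIsetP => n u _ _ /eqP nu; apply/seteqP; split => // w [[_ gn] [_ gu]].
  by case: nu; rewrite -gn.
have AE : A = \bigcup_(n in A) [set n] by rewrite bigcup_imset1 image_id.
rewrite [in RHS]AE measure_bigcup//; last first.
  apply/trivIsetP => n u _ _ /eqP nu; apply/seteqP; split => // v [vn vu].
  by case: nu; rewrite -vn -vu.
by rewrite -nneseriesZl//; apply: eq_eseriesr => n _; exact: PE.
Qed.

(** Summing out one slot at a time turns the probabilities on complete trajectories into a [mean];
    measurability passes along as a finite union. *)
Lemma mean_law d (W : measurableType d) (R : realType) (Q : probability W R)
    (p r : R) (N m M : nat) (w : 'I_M -> R)
    (X : W -> nat -> {ffun 'I_N -> bool}) (Y : W -> nat -> {ffun 'I_N -> 'I_M})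
    (E : set W) x0 y0 (e : (nat -> {ffun 'I_N -> bool}) -> (nat -> {ffun 'I_N -> 'I_M}) -> R) :
  (forall x y, let F := E `&` [set v | forall t, (0 < t <= m)%N -> X v t = x t /\ Y v t = y t] in
    measurable F /\
    fine (Q F) = (\prod_(1 <= t < m.+1)
      (chan_kernel p r m x t (x t) * delay_kernel w y t (y t))) * e x y) ->
  measurable E /\ fine (Q E) = mean p r m w x0 y0 e.
Proof.
move=> hE.
pose F t x y := E `&` [set v | forall s, (t < s <= m)%N -> X v s = x s /\ Y v s = y s].
suff H t : (t <= m)%N -> forall x y, measurable (F t x y) /\ fine (Q (F t x y)) =
    (\prod_(t.+1 <= s < m.+1) (chan_kernel p r m x s (x s) * delay_kernel w y s (y s))) *
    sweep (chan_kernel p r m) t (fun x => sweep (delay_kernel w) t (e x) y) x.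
  have := H m (leqnn m) x0 y0; rewrite big_geq// mul1r.
  suff -> : F m x0 y0 = E by [].
  by apply/seteqP; split => [v []//|v Ev]; split=> // s; rewrite ltnNge andNb.
elim: t => [|t IH] tm x y; first exact: hE.
pose g v := (X v t.+1, Y v t.+1).
have Fg z : F t.+1 x y `&` [set v | g v = z] = F t (set_slot x t.+1 z.1) (set_slot y t.+1 z.2).
  apply/seteqP; split => v.
    move=> [[Ev xy] gz]; split=> // s /andP[ts sm]; rewrite /set_slot.
    by case: eqP => [->|/eqP st]; [rewrite -gz|apply: xy; rewrite sm andbT ltn_neqAle eq_sym st].
  move=> [Ev xy]; split; first split=> // s /andP[ts sm].
    by have := xy s; rewrite (ltnW ts) sm /set_slot gtn_eqF//; apply.
  by have := xy t.+1; rewrite ltnSn tm /set_slot eqxx => /(_ isT)[e1 e2]; rewrite /g /= e1 e2; case: (z).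
have mF z : measurable (F t.+1 x y `&` [set v | g v = z]).
  by rewrite Fg; exact: (IH (ltnW tm) _ _).1.
split.
  have -> : F t.+1 x y = \bigcup_(z in [set: {ffun 'I_N -> bool} * {ffun 'I_N -> 'I_M}])
      (F t.+1 x y `&` [set v | g v = z]).
    by apply/seteqP; split => [v Fv|v [z _ []]//]; exists (g v).
  by apply: fin_bigcup_measurable => //; exact: finite_finset.
rewrite (fine_fin_partition Q mF).
transitivity (\sum_a \sum_b fine (Q (F t (set_slot x t.+1 a) (set_slot y t.+1 b)))).
  by rewrite pair_bigA; apply: eq_bigr => z _; rewrite Fg.
rewrite [sweep _ _ _ _]/= mulr_sumr; apply: eq_bigr => a _.
rewrite [sweep (chan_kernel p r m) t _ _](_ : _ = sweep (chan_kernel p r m) t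
  (fun x => \sum_b delay_kernel w y t.+1 b *
    sweep (delay_kernel w) t (e x) (set_slot y t.+1 b)) (set_slot x t.+1 a))//.
rewrite sweep_sum mulr_sumr mulr_sumr; apply: eq_bigr => b _.
rewrite (IH (ltnW tm) _ _).2 sweepZ big_ltn//= /set_slot eqxx.
(* The weights of the slots above [t + 1] do not see the new value in slot [t + 1], since kernels
   look only at earlier slots. *)
rewrite [X in _ * X * _](_ : _ = \prod_(t.+2 <= s < m.+1)
  (chan_kernel p r m x s (x s) * delay_kernel w y s (y s))).
  rewrite [chan_kernel _ _ _ _ _ _](_ : _ = chan_kernel p r m x t.+1 a).
    by rewrite /delay_kernel; ring.
  by rewrite /chan_kernel /user_kernel gtn_eqF.
apply: eq_big_nat => s /andP[ts _]; rewrite gtn_eqF//.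
by rewrite /chan_kernel /user_kernel gtn_eqF// ltnW.
Qed.

Lemma measurable_all d (W : measurableType d) (T : eqType) (s : seq T)
    (F : T -> set W) : (forall x, measurable (F x)) ->
  measurable [set v | forall x, x \in s -> F x v].
Proof.
move=> mF; elim: s => [|a s IH].
  by rewrite [X in measurable X](_ : _ = setT)//; apply/seteqP; split.
rewrite [X in measurable X](_ : _ = F a `&` [set v | forall x, x \in s -> F x v]).
  exact: measurableI.
apply/seteqP; split => [v h|v [Fa h] x /=].
  by split=> [|x xs]; apply: h; rewrite inE ?eqxx// xs orbT.
by rewrite inE => /orP[/eqP->//|/h].
Qed.

Section downlink_law.
Context (R : realType) (N : nat) (p r : R) (PD : probability nat R).
Context (m : nat) (L : downlink N p r PD m).
Local Notation P := (dl_prob L).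
Local Notation ps := (stat_on p r).

Lemma measurable_chan i t (B : set bool) : measurable [set w | B (chan L i t w)].
Proof.
rewrite -[X in measurable X]setTI.
exact: (measurable_funPT (chan L i t) measurableT B).
Qed.

Lemma measurable_delay i t (B : set nat) : measurable [set w | B (delay L i t w)].
Proof.
rewrite -[X in measurable X]setTI.
exact: (measurable_funPT (delay L i t) measurableT B).
Qed.

Definition chan_path (w : dl_space L) (t : nat) : {ffun 'I_N -> bool} :=
  [ffun i => chan L i t w].
Definition delay_path (w : dl_space L) (t : nat) : {ffun 'I_N -> 'I_m.+1} :=
  [ffun i => cap m (delay L i t w)].

Lemma path_prob i (x : nat -> {ffun 'I_N -> bool}) t : (t <= m)%N ->
  P [set w | forall s, (t < s <= m)%N -> chan L i s w = x s i] =
  (\prod_(t.+1 <= s < m.+1) user_kernel p r m x s i (x s i))%:E.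
Proof.
move=> tm; rewrite -(subKn tm); elim: (m - t)%N (leq_subr t m) => [|n IH] nm.
  rewrite subn0 big_geq// [X in P X](_ : _ = setT) ?probability_setT//.
  by apply/seteqP; split => // w _ s; rewrite ltnNge andNb.
have e : (m - n.+1).+1 = (m - n)%N by rewrite subnSK.
rewrite big_ltn; last by lia.
rewrite [in RHS]e.
(* The first slot uses the initial law, with OFF as the complement of ON; the later ones use the
   Markov property. *)
have [n0|n0] := eqVneq n 0%N.
  rewrite n0 subn0 big_geq// mulr1 /user_kernel ltnn.
  have m0 : (0 < m)%N by lia.
  have -> : [set w | forall s, (m - 1 < s <= m)%N -> chan L i s w = x s i] =
      [set w | chan L i m w = x m i].
    apply/seteqP; split => w /= h; first by apply: h; lia.
    by move=> s sm; have -> : s = m by lia.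
  case: (x m i); first exact: chan_init.
  have := probability_setC P (measurable_chan i m [set true]).
  rewrite (chan_init L i m0) -EFinB => <-; congr (P _).
  by apply/seteqP; split => w /=; case: (chan L i m w).
have := @chan_markov _ _ _ _ _ _ L i (fun s => x s i) (m - n)%N.
rewrite (_ : (1 <= m - n < m)%N = true); last by lia.
move=> /(_ isT); have -> : [set w | forall t', (m - n <= t' <= m)%N -> chan L i t' w = x t' i]
  = [set w | forall s, (m - n.+1 < s <= m)%N -> chan L i s w = x s i].
  by apply/seteqP; split => w /= h s hs; apply: h; lia.
move=> ->; rewrite IH ?(ltnW nm)// -EFinM mulrC /user_kernel ifT//; lia.
Qed.

Definition cells : seq ('I_N * nat) :=
  [seq (i, t) | i <- enum 'I_N, t <- index_iota 1 m.+1].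

Lemma mem_cells x : (x \in cells) = (0 < x.2 <= m)%N.
Proof.
case: x => i t; apply/allpairsP/idP => [[[j s] [_ /=]]|h].
  by rewrite mem_index_iota => ? [_ ->].
by exists (i, t); split; rewrite ?mem_enum// mem_index_iota.
Qed.

Lemma uniq_cells : uniq cells.
Proof.
by apply: allpairs_uniq; rewrite ?enum_uniq ?iota_uniq// => -[a b] [c d] _ _ [-> ->].
Qed.

Lemma big_cells (F : 'I_N * nat -> R) :
  \prod_(x <- cells) F x = \prod_(1 <= t < m.+1) \prod_i F (i, t).
Proof. by rewrite big_allpairs exchange_big/=; apply: eq_bigr => t _; rewrite big_enum. Qed.

Hypotheses (hp : 0 <= p <= 1) (hr : 0 <= r <= 1) (hnd : p + (1 - r) < 2).

(** Induction on [ys]: with all delays fixed this is [dl_indep], and each step frees one delay from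
    a single value to a set. *)
Lemma indep_cells (x : nat -> {ffun 'I_N -> bool}) (ys zs : seq ('I_N * nat))
    (A : 'I_N * nat -> set nat) (d : 'I_N * nat -> nat) : cells = ys ++ zs ->
  let F := [set w | (forall c, c \in cells -> chan L c.1 c.2 w = x c.2 c.1) /\
     (forall c, c \in ys -> A c (delay L c.1 c.2 w)) /\
     (forall c, c \in zs -> delay L c.1 c.2 w = d c)] in
  measurable F /\
  P F = ((\prod_(c <- cells) user_kernel p r m x c.2 c.1 (x c.2 c.1)) *
    (\prod_(c <- ys) fine (PD (A c))) * (\prod_(c <- zs) fine (PD [set d c])))%:E.
Proof.
move=> def; have mF (ys' zs' : seq ('I_N * nat)) (d' : 'I_N * nat -> nat) : measurable
    [set w | (forall c, c \in cells -> chan L c.1 c.2 w = x c.2 c.1) /\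
     (forall c, c \in ys' -> A c (delay L c.1 c.2 w)) /\
     (forall c, c \in zs' -> delay L c.1 c.2 w = d' c)].
  apply: measurableI; first by apply: measurable_all => c; exact: (measurable_chan _ _ (eq^~ _)).
  apply: measurableI.
        apply: (@measurable_all _ _ _ _ (fun c => [set w | A c (delay L c.1 c.2 w)])) => c.
    exact: measurable_delay.
  apply: (@measurable_all _ _ _ _ (fun c => [set w | delay L c.1 c.2 w = d' c])) => c.
  exact: (measurable_delay _ _ (eq^~ _)).
move=> F; split; first exact: mF.
rewrite /F {F}; elim/last_ind: ys zs def d => [|ys a IH] zs def d.
  rewrite cat0s in def; subst zs.
  have := dl_indep L (fun i t => x t i) (fun i t => d (i, t)).
  rewrite (_ : [set w | _] = [set w |
      (forall c, c \in cells -> chan L c.1 c.2 w = x c.2 c.1) /\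
      (forall c, c \in [::] -> A c (delay L c.1 c.2 w)) /\
      (forall c, c \in cells -> delay L c.1 c.2 w = d c)]); last first.
    apply/seteqP; split => w /=.
      move=> h; have hc c : c \in cells -> chan L c.1 c.2 w = x c.2 c.1 /\
          delay L c.1 c.2 w = d c by case: c => i t; rewrite mem_cells => /h.
      by split; [|split] => // c /hc[].
    move=> [h1 [_ h2]] i t it; have c : (i, t) \in cells by rewrite mem_cells.
    by split; [exact: (h1 _ c)|exact: (h2 _ c)].
  move=> ->; rewrite big_nil mulr1.
  rewrite (eq_bigr (fun i => (\prod_(1 <= s < m.+1) user_kernel p r m x s i (x s i))%:E)); last first.
    by move=> i _; rewrite -path_prob.
  rewrite [X in (_ * X)%E](eq_bigr (fun i => (\prod_(1 <= s < m.+1) fine (PD [set d (i, s)]))%:E)); last first.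
    move=> i _; rewrite -prodEFin; apply: eq_big_nat => t tm.
    by rewrite fineK ?fin_num_measure// -(delay_law L i (t := t) [set d (i, t)] tm).
  rewrite !prodEFin -EFinM !big_cells; congr (_ * _)%:E; by rewrite exchange_big.
rewrite cat_rcons in def.
have azs : a \notin zs by have := uniq_cells; rewrite def cat_uniq => /and3P[_ _ /andP[]].
pose E := [set w | (forall c, c \in cells -> chan L c.1 c.2 w = x c.2 c.1) /\
   (forall c, c \in ys -> A c (delay L c.1 c.2 w)) /\
   (forall c, c \in zs -> delay L c.1 c.2 w = d c)].
pose da n c := if c == a then n else d c.
have En n : E `&` [set w | delay L a.1 a.2 w = n] = [set w |
   (forall c, c \in cells -> chan L c.1 c.2 w = x c.2 c.1) /\
   (forall c, c \in ys -> A c (delay L c.1 c.2 w)) /\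
   (forall c, c \in a :: zs -> delay L c.1 c.2 w = da n c)].
  apply/seteqP; split => w /=.
    move=> [[h1 [h2 h3]] h]; split=> //; split=> // c; rewrite inE /da.
    by case: eqP => [-> //|_ /= /h3].
  move=> [h1 [h2 h3]]; split; last by have := h3 a; rewrite /da inE eqxx; apply.
  split=> //; split=> // c cz; have := h3 c; rewrite inE cz orbT /da.
  by case: eqP cz azs => [-> ->//|_ _ _]; apply.
have -> : [set w | (forall c, c \in cells -> chan L c.1 c.2 w = x c.2 c.1) /\
     (forall c, c \in rcons ys a -> A c (delay L c.1 c.2 w)) /\
     (forall c, c \in zs -> delay L c.1 c.2 w = d c)] =
   E `&` [set w | A a (delay L a.1 a.2 w)].
  apply/seteqP; split => w /=.
    move=> [h1 [h2 h3]]; split; last by apply: h2; rewrite mem_rcons inE eqxx.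
    by split=> //; split=> // c cy; apply: h2; rewrite mem_rcons inE cy orbT.
  move=> [[h1 [h2 h3]] h]; split=> //; split=> // c.
  by rewrite mem_rcons inE => /orP[/eqP->//|/h2].
pose c0 := (\prod_(c <- cells) user_kernel p r m x c.2 c.1 (x c.2 c.1)) *
    (\prod_(c <- ys) fine (PD (A c))) * (\prod_(c <- zs) fine (PD [set d c])).
have [|||_ ->] := @nat_fiber_measure _ _ _ P PD (delay L a.1 a.2) E c0 (A a).
- apply: mulr_ge0; last by apply: prodr_ge0 => *; exact: fine_ge0.
  apply: mulr_ge0; last by apply: prodr_ge0 => *; exact: fine_ge0.
  by apply: prodr_ge0 => *; exact: user_kernel_ge0.
- by move=> n; rewrite En; exact: mF.
- move=> n; rewrite En (IH _ def) big_cons {1}/da eqxx.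
  have -> : \prod_(c <- zs) fine (PD [set da n c]) = \prod_(c <- zs) fine (PD [set d c]).
    apply: eq_big_seq => c cz; rewrite /da ifF//.
    by apply: contraNF azs => /eqP <-.
  rewrite -[PD [set n]]fineK ?fin_num_measure// -EFinM /c0; congr (_%:E); ring.
rewrite -[PD (A a)]fineK ?fin_num_measure// -EFinM /c0 big_rcons/=; congr (_%:E); ring.
Qed.

Lemma path_law (x : nat -> {ffun 'I_N -> bool}) (y : nat -> {ffun 'I_N -> 'I_m.+1}) :
  let F := [set w | forall t, (0 < t <= m)%N -> chan_path w t = x t /\ delay_path w t = y t] in
  measurable F /\ fine (P F) = \prod_(1 <= t < m.+1)
    (chan_kernel p r m x t (x t) * delay_kernel (delay_weight PD (m := m)) y t (y t)).
Proof.
have := @indep_cells x cells [::] (fun c => [set d | cap m d = y c.2 c.1]) (fun=> 0%N).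
rewrite cats0 => /(_ erefl) /=.
set F := [set w | _]; set G := [set w | forall t, _]; have -> : F = G.
  apply/seteqP; split => w /=.
    move=> [h1 [h2 _]] t tm.
    have c i : (i, t) \in cells by rewrite mem_cells.
    by split; apply/ffunP => i; rewrite ffunE; [exact: (h1 _ (c i))|exact: (h2 _ (c i))].
  move=> h; have hc c : c \in cells -> chan L c.1 c.2 w = x c.2 c.1 /\
      cap m (delay L c.1 c.2 w) = y c.2 c.1.
    by case: c => i t; rewrite mem_cells => /h[<- <-] /=; rewrite !ffunE.
  by split; [|split] => // c /hc[].
move=> [mG ->]; split=> //=; rewrite big_nil mulr1 !big_cells -big_split/=.
by apply: eq_bigr.
Qed.

End downlink_law.

(** * Policies and beliefs *)

Section policy_law.
Context (R : realType) (N : nat) (p r : R) (PD : probability nat R).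
Hypotheses (hp : 0 <= p <= 1) (hr : 0 <= r <= 1) (hnd : p + (1 - r) < 2).
Context (m : nat) (L : downlink N p r PD m) (A : policy R N).
Local Notation J := (joint_law A L).
Local Notation slotS := {ffun 'I_N -> bool}.
Local Notation slotD := {ffun 'I_N -> 'I_m.+1}.
Local Notation avg :=
  (mean p r m (delay_weight PD (m := m)) (fun=> [ffun=> false]) (fun=> [ffun=> ord0])).

Definition local_event U (Phi : (nat -> slotS) -> (nat -> slotD) -> U -> Prop) :=
  forall x x' y y' u, (forall t, (0 < t <= m)%N -> x t = x' t /\ y t = y' t) ->
    Phi x y u -> Phi x' y' u.

(** Once the trajectories are fixed the event is a rectangle, and its product measure is the path
    weight times a probability of the seed. *)
Lemma joint_event Phi : local_event Phi ->
  (forall x y, measurable [set u : seed A | Phi x y u]) ->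
  let E := [set w : dl_space L * seed A | Phi (chan_path (L := L) w.1) (delay_path (L := L) w.1) w.2] in
  measurable E /\
  fine (J E) = avg (fun x y => fine (seed_law A [set u | Phi x y u])).
Proof.
move=> loc mPhi E.
apply: (mean_law (X := fun w => chan_path (L := L) w.1) (Y := fun w => delay_path (L := L) w.1)) => x y F.
pose B := [set w : dl_space L | forall t, (0 < t <= m)%N -> chan_path w t = x t /\ delay_path w t = y t].
have [mB PB] := path_law L hp hr hnd x y.
have -> : F = B `*` [set u | Phi x y u].
  apply/seteqP; split => -[w u] /= [].
    move=> e h; split => //; apply: loc e => t tm; exact: h.
  move=> h e; split => //; apply: loc e => t tm; have [-> ->//] := h t tm.
split; first exact: measurableX.
rewrite [J _](_ : _ = (dl_prob L B * seed_law A [set u | Phi x y u])%E); last first.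
  exact: product_measure1E.
by rewrite fineM ?fin_num_measure// PB.
Qed.

Lemma section_event Phi (u : seed A) : local_event Phi ->
  let E := [set w | Phi (chan_path (L := L) w) (delay_path (L := L) w) u] in
  measurable E /\
  fine (dl_prob L E) = avg (fun x y => (`[< Phi x y u >])%:R).
Proof.
move=> loc E.
apply: (mean_law (X := chan_path (L := L)) (Y := delay_path (L := L))) => x y F.
pose B := [set w : dl_space L | forall t, (0 < t <= m)%N -> chan_path w t = x t /\ delay_path w t = y t].
have [mB PB] := path_law L hp hr hnd x y.
case: asboolP => [h|nh].
  have -> : F = B.
    apply/seteqP; split => [w []//|w Bw]; split => //.
    by apply: loc h => t tm; have [-> ->] := Bw t tm.
  by rewrite mulr1; split.
rewrite mulr0; have -> : F = set0 by apply/seteqP; split => // w [e Bw]; apply: nh; exact: loc e.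
by rewrite measure0; split.
Qed.

(** A bound valid for every fixed seed survives randomization: the product measure is integrated
    over the seed last. *)
Lemma joint_le Phi c : local_event Phi ->
  (forall x y, measurable [set u : seed A | Phi x y u]) ->
  (forall u, avg (fun x y => (`[< Phi x y u >])%:R) <= c) ->
  avg (fun x y => fine (seed_law A [set u | Phi x y u])) <= c.
Proof.
move=> loc mPhi hc; have [mE <-] := joint_event loc mPhi.
set E := [set w | _] in mE *.
have JE : J E = (dl_prob L \x^ seed_law A)%E E.
  by apply: product_measure_unique => //= ? ? ? ?; rewrite product_measure2E.
rewrite -lee_fin fineK ?fin_num_measure// JE.
apply: (@le_trans _ _ (\int[seed_law A]_u c%:E)%E).
  apply: ge0_le_integral => //.
    exact: measurable_fun_ysection.
  move=> u _ /=; have [mEu e] := section_event u loc.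
  rewrite (_ : ysection E u = [set w | Phi (chan_path (L := L) w) (delay_path (L := L) w) u]).
    by rewrite -[leLHS]fineK ?fin_num_measure// lee_fin e.
  by apply/seteqP; split => w; rewrite /ysection /= ?inE.
by rewrite integral_cst//= probability_setT mule1.
Qed.

End policy_law.

(** * Expected belief of the scheduled user as a probability of success *)

Section belief_theory.
Context (R : realType) (N : nat) (p r : R) (PD : probability nat R).
Context (m : nat) (L : downlink N p r PD m) (A : policy R N).
Local Notation J := (joint_law A L).
Local Notation slotS := {ffun 'I_N -> bool}.
Local Notation slotD := {ffun 'I_N -> 'I_m.+1}.
Local Notation avg :=
  (mean p r m (delay_weight PD (m := m)) (fun=> [ffun=> false]) (fun=> [ffun=> ord0])).
Implicit Types (x : nat -> slotS) (y : nat -> slotD) (u : seed A).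

Definition seed_rule u ds fb := rule m ds fb u.
Definition seed_reports k x y u :=
  reports (seed_rule u) (curry_chan x) (curry_delay y) m k.
Definition seed_act k x y u :=
  act (seed_rule u) (curry_chan x) (curry_delay y) m k.

(** Truncated subtraction gives 0 on both sides once the delay reaches [m]. *)
Let cap_delay w j i : (m - j - delay L i (m - j) w =
  m - j - curry_delay (delay_path (L := L) w) i (m - j))%N.
Proof. by rewrite /curry_delay ffunE capE; lia. Qed.

Let curry_chanE (w : dl_space L) i t : curry_chan (chan_path w) i t = chan L i t w.
Proof. by rewrite /curry_chan ffunE. Qed.

Lemma feedbackE k (w : dl_space L * seed A) : (k <= m)%N ->
  feedback k w = seed_reports k (chan_path w.1) (delay_path w.1) w.2.
Proof.
by move=> km; apply/esym/eq_reports => // j i _ _; rewrite curry_chanE -cap_delay.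
Qed.

Lemma actionE k (w : dl_space L * seed A) : (k <= m)%N ->
  action k w = seed_act k (chan_path w.1) (delay_path w.1) w.2.
Proof.
by move=> km; apply/esym/eq_act => // j i _ _; rewrite curry_chanE -cap_delay.
Qed.

(** Induction on [n], splitting over the finitely many values of the last decision; [Psi] mentions
    the seed because that decision does. *)
Lemma measurable_decisions S D n (Psi : seq (option 'I_N) -> seed A -> Prop) :
  (forall ds, measurable [set u | Psi ds u]) ->
  measurable [set u | Psi (decisions (seed_rule u) S D m n) u].
Proof.
elim: n Psi => [|n IH] Psi mPsi /=; first exact: mPsi.
apply: (IH (fun ds u => Psi (rcons ds (rule m ds (arrived S D m (m - n) ds) u)) u)) => ds.
rewrite (_ : [set u | _] = \bigcup_(a in [set: option 'I_N])
   ([set u | rule m ds (arrived S D m (m - n) ds) u = a] `&` [set u | Psi (rcons ds a) u])).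
  apply: fin_bigcup_measurable => [|a _]; first exact: finite_finset.
  by apply: measurableI; [exact: rule_measurable|exact: mPsi].
apply/seteqP; split => [u h|u [a _ [/= -> //]]].
by exists (rule m ds (arrived S D m (m - n) ds) u).
Qed.

Lemma measurable_outcome k x y (Psi : seq (report N) -> option 'I_N -> Prop) :
  measurable [set u | Psi (seed_reports k x y u) (seed_act k x y u)].
Proof.
pose S := curry_chan x; pose D := curry_delay y.
apply: (@measurable_decisions S D (m - k)%N (fun ds u =>
  Psi (arrived S D m k ds) (rule m ds (arrived S D m k ds) u))) => ds.
rewrite (_ : [set u | _] = \bigcup_(a in [set a | Psi (arrived S D m k ds) a])
   [set u | rule m ds (arrived S D m k ds) u = a]).
  apply: fin_bigcup_measurable => [|a _]; first exact: finite_finset.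
  exact: rule_measurable.
by apply/seteqP; split => [u h|u [a h /= -> //]]; exists (rule m ds (arrived S D m k ds) u).
Qed.

Lemma local_outcome k (Psi : bool -> seq (report N) -> option 'I_N -> Prop) i :
  (0 < k <= m)%N ->
  local_event (fun x y u => Psi (x k i) (seed_reports k x y u) (seed_act k x y u)).
Proof.
move=> /andP[k0 km] x x' y y' u xy.
have xi : x k i = x' k i by have [] := xy k; rewrite ?k0// => ->.
have e j i' : (j < m - k)%N -> seed_act (m - j) x y u = Some i' ->
    (m - j - curry_delay y i' (m - j) = m - j - curry_delay y' i' (m - j))%N /\
    ((k < m - j - curry_delay y i' (m - j))%N ->
     curry_chan x i' (m - j)%N = curry_chan x' i' (m - j)%N).
  move=> jmk _; rewrite /curry_chan /curry_delay.
  have jm : (0 < m - j <= m)%N by lia.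
  by have [-> ->] := xy _ jm.
by rewrite xi /seed_act /seed_reports (eq_reports km e) (eq_act km e).
Qed.

Hypotheses (hp : 0 <= p <= 1) (hr : 0 <= r <= 1) (hnd : p + (1 - r) < 2).

Lemma outcome_law k (Psi : bool -> seq (report N) -> option 'I_N -> Prop) i :
  (0 < k <= m)%N ->
  let E := [set w : dl_space L * seed A | Psi (chan L i k w.1) (feedback k w) (action k w)] in
  measurable E /\ fine (J E) = avg (fun x y => fine (seed_law A
    [set u | Psi (x k i) (seed_reports k x y u) (seed_act k x y u)])).
Proof.
move=> km /=; have := joint_event hp hr hnd L (@local_outcome k Psi i km).
rewrite (_ : [set w | _] = [set w : dl_space L * seed A |
    Psi (chan L i k w.1) (feedback k w) (action k w)]).
  by apply=> x y; exact: measurable_outcome.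
have /andP[_ km'] := km; apply/seteqP; split => w /=; by rewrite feedbackE// actionE// ffunE.
Qed.

Definition observed k i (F : seq (report N)) (b c : bool) :=
  [set w : dl_space L * seed A | (b ==> chan L i k w.1) /\ feedback k w = F /\
     (c -> action k w = Some i)].

(* The factorization says that, given the feedback, the channel is independent
   of the decision. *)
Lemma observed_indep k i F : (0 < k <= m)%N -> exists s q : bool -> R,
  [/\ forall b c, fine (J (observed k i F b c)) = s b * q c,
      0 <= s true <= s false & 0 <= q true <= q false].
Proof.
move=> km; have /andP[k0 km'] := km.
have dk := @delay_is_kernel R N m.+1 _ (delay_weight_ge0 PD (m := m)) (sum_delay_weight PD m).
have law b c : fine (J (observed k i F b c)) = avg (fun x y => fine (seed_law A
    [set u | (b ==> x k i) /\ seed_reports k x y u = F /\ (c -> seed_act k x y u = Some i)])).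
  exact: (outcome_law (fun z fb a => (b ==> z) /\ fb = F /\ (c -> a = Some i)) i km).2.
(* If nothing can produce the feedback [F], all four events are null and zero factors do. *)
have [[x1 [y1 [u1 e1]]]|none] := pselect (exists x y u, seed_reports k x y u = F); last first.
  exists (fun=> 0), (fun=> 0); split; rewrite ?lexx// => b c; rewrite law mul0r.
  transitivity (avg (fun (_ : nat -> slotS) (_ : nat -> slotD) => 0)).
    apply: eq_mean => x y; rewrite [X in seed_law A X](_ : _ = set0) ?measure0//.
    by apply/seteqP; split => // u [_ [e _]]; apply: none; exists x, y, u.
  by apply: (sweep_cst (chan_is_kernel hp hr hnd N m)) => z _; apply: (sweep_cst dk).
(* [M] selects the channel trajectories compatible with [F]. On these, [reports_cross] allows [x] to
   be replaced by the reference [x1], so [G] involves only delays and seed. *)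
pose M x : bool := `[< exists y u, seed_reports k x y u = F >].
pose G c y := fine (seed_law A [set u | seed_reports k x1 y u = F /\ (c -> seed_act k x1 y u = Some i)]).
have cross x y u : M x -> (seed_reports k x y u = F <-> seed_reports k x1 y u = F) /\
    (seed_reports k x1 y u = F -> seed_act k x y u = seed_act k x1 y u).
  move=> /asboolP[y2 [u2 e2]].
  have c1 : seed_reports k x1 y u = F -> seed_reports k x y u = F /\ seed_act k x y u = seed_act k x1 y u.
    move=> e; have := @reports_cross _ (seed_rule u2) (seed_rule u) (curry_chan x) (curry_delay y2)
      (curry_chan x1) (curry_delay y) m k km'.
    rewrite -/(seed_reports k x y2 u2) -/(seed_reports k x1 y u) e2 e => /(_ erefl)[h1 h2].
    by split.
  split; last by move=> /c1[].
  split=> [e|/c1[]//].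
  have := @reports_cross _ (seed_rule u1) (seed_rule u) (curry_chan x1) (curry_delay y1)
      (curry_chan x) (curry_delay y) m k km'.
  by rewrite -/(seed_reports k x1 y1 u1) -/(seed_reports k x y u) e1 e => /(_ erefl)[].
exists (fun b => sweep (chan_kernel p r m) m (fun x => (M x && (b ==> x k i))%:R) (fun=> [ffun=> false])).
exists (fun c => sweep (delay_kernel (delay_weight PD (m := m))) m (G c) (fun=> [ffun=> ord0])).
split.
- move=> b c; rewrite law.
  rewrite mulrC -(@mean_chan R p r N m m.+1 (delay_weight PD (m := m)) _
    (fun=> [ffun=> ord0]) _ (fun=> G c) _ (fun=> erefl)).
  apply: eq_mean => x y; case: (boolP (M x)) => [Mx|nM]; last first.
    rewrite mul0r [X in seed_law A X](_ : _ = set0) ?measure0//.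
    apply/seteqP; split => // u [_ [e _]]; case/negP: nM; apply/asboolP; by exists y, u.
  case: (b ==> x k i); last first.
    rewrite mul0r [X in seed_law A X](_ : _ = set0) ?measure0//.
    by apply/seteqP; split => // u [].
  rewrite mul1r /G; congr (fine (seed_law A _)); apply/seteqP; split => u /=.
    move=> [_ [/(cross _ _ _ Mx).1 e h]]; split=> // /h <-; exact/esym/(cross _ _ _ Mx).2.
  move=> [e h]; split=> //; split; first exact/(cross _ _ _ Mx).1.
  by move=> /h <-; exact: (cross _ _ _ Mx).2.
- apply/andP; split; first by apply: sweep_ge0 => //; exact: chan_is_kernel.
  apply: ler_sweep => [|x _]; first exact: chan_is_kernel.
  by rewrite ler_nat; case: (M x); case: (x k i).
- apply/andP; split; first by apply: sweep_ge0 => // y; exact: fine_ge0.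
  apply: ler_sweep => [|y _]; first exact: dk.
  have mG c : measurable [set u | seed_reports k x1 y u = F /\ (c -> seed_act k x1 y u = Some i)].
    exact: (measurable_outcome k x1 y (fun fb a => fb = F /\ (c -> a = Some i))).
  apply: fine_le; rewrite ?fin_num_measure//.
  by apply: le_measure; rewrite ?inE// => u [e _]; split.
Qed.

(** In product form the factors [s false] and [q false] cancel; if one of them is 0, the
    inequalities force its numerator to vanish too. *)
Lemma belief_observed k i F : (0 < k <= m)%N ->
  fine (J (observed k i F true false)) / fine (J (observed k i F false false)) *
    fine (J (observed k i F false true)) = fine (J (observed k i F true true)).
Proof.
move=> km; have [s [q [e /andP[s0 s1] /andP[q0 q1]]]] := observed_indep i F km.
rewrite !e; have [sf|sf] := eqVneq (s false) 0.
  have -> : s true = 0 by apply/eqP; rewrite eq_le s0 andbT -sf.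
  by rewrite !mul0r.
have [qf|qf] := eqVneq (q false) 0.
  have -> : q true = 0 by apply/eqP; rewrite eq_le q0 andbT -qf.
  by rewrite !mulr0.
by field; rewrite sf qf.
Qed.

Definition scheduled_on k i :=
  [set w : dl_space L * seed A | chan L i k w.1 /\ action k w = Some i].

Lemma measurable_scheduled_on k i : (0 < k <= m)%N -> measurable (scheduled_on k i).
Proof.
by move=> km; apply: (outcome_law (fun z _ a => z /\ a = Some i) i km).1.
Qed.

Lemma integral_belief k i : (0 < k <= m)%N ->
  measurable_fun [set: dl_space L * seed A]
    (fun w => belief k i w * (action (L := L) (A := A) k w == Some i)%:R : R) /\
  (\int[J]_w (belief k i w * (action k w == Some i)%:R)%:E)%E = J (scheduled_on k i).
Proof.
move=> km.
(* The integrand depends only on feedback and decision, a countable datum; the integral is summed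
   over its fibers, on each of which [belief_observed] applies. *)
pose phi (w : dl_space L * seed A) : nat := pickle (feedback k w, action k w).
have mphi B : measurable [set w | B (phi w)].
  exact: (outcome_law (fun _ fb a => B (pickle (fb, a))) i km).1.
pose beta F := fine (J (observed k i F true false)) / fine (J (observed k i F false false)).
have belE (w : dl_space L * seed A) : belief k i w = beta (feedback k w).
  have e1 : [set w' | chan L i k w'.1 /\ feedback k w' = feedback k w] =
      observed k i (feedback k w) true false.
    by apply/seteqP; split => v /=; rewrite /observed /=; [move=> []|move=> [? []]].
  have e2 : [set w' : dl_space L * seed A | feedback k w' = feedback k w] =
      observed k i (feedback k w) false false.
    by apply/seteqP; split => v /=; rewrite /observed /=; [|move=> [_ []]].
  by rewrite /belief e1 e2.
pose h (n : nat) : R := if (unpickle n : option (seq (report N) * option 'I_N)) is Some (F, a) then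
  beta F * (a == Some i)%:R else 0.
have hphi (w : dl_space L * seed A) : belief k i w * (action k w == Some i)%:R = h (phi w).
  by rewrite /h /phi pickleK belE.
have beta0 F : 0 <= beta F by apply: divr_ge0; exact: fine_ge0.
have h0 n : 0 <= h n by rewrite /h; case: unpickle => // -[F a]; rewrite mulr_ge0.
have mh : measurable_fun [set: dl_space L * seed A] (fun w => h (phi w) : R).
  by move=> _ B mB; rewrite setTI; exact: (mphi (fun n => B (h n))).
split; first by under eq_fun do rewrite hphi.
under eq_integral do rewrite hphi.
have mD n : measurable [set w | phi w = n] by exact: (mphi (eq^~ n)).
have tD : trivIset setT (fun n => [set w | phi w = n]).
  by apply/trivIsetP => a b _ _ /eqP ab; apply/seteqP; split => // w [/= wa wb]; case: ab; rewrite -wa.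
have UT : setT = \bigcup_n [set w | phi w = n] by apply/seteqP; split => // w _; exists (phi w).
have mS := measurable_scheduled_on i km.
have US : scheduled_on k i = \bigcup_n (scheduled_on k i `&` [set w | phi w = n]).
  by apply/seteqP; split => [w hw|w [n _ []]//]; exists (phi w).
rewrite [in LHS]UT ge0_integral_bigcup//; last 2 first.
- by rewrite -UT; exact/measurable_EFinP.
- by move=> w _; rewrite lee_fin.
rewrite [in RHS]US measure_semi_bigcup; last 3 first.
- by move=> n; exact: measurableI.
- apply/trivIsetP => a b _ _ /eqP ab; apply/seteqP; split => // w [[_ /= wa] [_ /= wb]].
  by case: ab; rewrite -wa.
- by rewrite -US.
apply: eq_eseriesr => n _.
transitivity ((h n)%:E * J [set w | phi w = n])%E.
  rewrite -integral_cst//; apply: eq_integral => w; rewrite inE /= => -> //.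
have [[w0 w0n]|none] := pselect (exists w, phi w = n); last first.
  have -> : [set w | phi w = n] = set0 by apply/seteqP; split => // w wn; apply: none; exists w.
  by rewrite setI0 !measure0 mule0.
have DE : [set w | phi w = n] =
    [set w | feedback k w = feedback k w0 /\ action k w = action k w0].
  apply/seteqP; split => w /=; rewrite -w0n; last by rewrite /phi => -[-> ->].
  by move=> /(pcan_inj pickleK) [].
have hn : h n = beta (feedback k w0) * (action k w0 == Some i)%:R.
  by rewrite -w0n -hphi belE.
rewrite hn DE; have [e|ne] := eqVneq (action k w0) (Some i); last first.
  have -> : scheduled_on k i `&`
      [set w | feedback k w = feedback k w0 /\ action k w = action k w0] = set0.
    by apply/seteqP; split => // w [[_ a1] [_ a2]]; case/eqP: ne; rewrite -a2.
  by rewrite mulr0 mul0e measure0.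
have -> : [set w | feedback k w = feedback k w0 /\ action k w = action k w0] =
    observed k i (feedback k w0) false true.
  apply/seteqP; split => w /=; rewrite /observed /= ?e; first by move=> [-> ->].
  by move=> [_ [-> ->]].
have -> : scheduled_on k i `&` observed k i (feedback k w0) false true =
    observed k i (feedback k w0) true true.
  apply/seteqP; split => w /=; rewrite /observed /scheduled_on /=; first by move=> [[-> ->] [_ [-> _]]].
  by move=> [-> [-> /(_ isT) ->]].
have mo b c : measurable (observed k i (feedback k w0) b c).
  exact: (outcome_law (fun z fb a => (b ==> z) /\ fb = feedback k w0 /\ (c -> a = Some i)) i km).1.
rewrite mulr1 -[RHS]fineK ?fin_num_measure// -belief_observed//.
by rewrite [RHS]EFinM fineK ?fin_num_measure.
Qed.

Lemma throughputE i : throughput A L i =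
  (\sum_(1 <= k < m.+1) fine (J (scheduled_on k i))) / m%:R.
Proof.
rewrite /throughput unlock; congr (_ / _).
(* Extended by 0 outside the horizon, the summand is measurable for every [k], as exchanging sum and
   integral requires. *)
pose f k (w : dl_space L * seed A) : R :=
  if (0 < k <= m)%N then belief k i w * (action k w == Some i)%:R else 0.
have f0 k w : 0 <= f k w.
  rewrite /f; case: ifP => // _; apply: mulr_ge0 => //.
  by apply: divr_ge0; exact: fine_ge0.
have mf k : measurable_fun [set: dl_space L * seed A] (f k).
  rewrite /f; case: (boolP (0 < k <= m)%N) => km; first exact: (integral_belief i km).1.
  exact: measurable_cst.
transitivity (fine (\int[J]_w (\sum_(1 <= k < m.+1) (f k w)%:E))).
  congr fine; apply: eq_integral => w _; rewrite /reward -sumEFin; apply: eq_big_nat => k km.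
  by rewrite /f -ltnS km.
rewrite ge0_integral_sum//; last 2 first.
- by move=> k; exact/measurable_EFinP.
- by move=> k w _; rewrite lee_fin.
have int k : (\int[J]_w (f k w)%:E)%E = if (0 < k <= m)%N then J (scheduled_on k i) else 0%E.
  rewrite /f; case: (boolP (0 < k <= m)%N) => km; last by rewrite integral0.
  exact: (integral_belief i km).2.
rewrite -sum_fine => [|k _]; last first.
  rewrite int; case: ifP => // km; apply: fin_num_measure.
  exact: measurable_scheduled_on.
by apply: eq_big_nat => k; rewrite ltnS => km; rewrite int km.
Qed.

Lemma scheduled_on_law k i : (0 < k <= m)%N ->
  fine (J (scheduled_on k i)) =
  avg (fun x y => fine (seed_law A [set u | x k i /\ seed_act k x y u = Some i])).
Proof. by move=> km; exact: (outcome_law (fun z _ a => z /\ a = Some i) i km).2. Qed.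

End belief_theory.

(** * Time sharing *)

Section policies.
Context (R : realType) (N : nat).

Section mix.
Context (t : R) (t01 : 0 <= t <= 1) (A B : policy R N).

(** One coin, tossed in advance and stored in the seed, selects the policy for the whole horizon. *)
Definition mix_rule m ds fb (u : bool * (seed A * seed B)) : option 'I_N :=
  if u.1 then rule m ds fb u.2.1 else rule m ds fb u.2.2.

Lemma mix_set (E : set (seed A)) (F : set (seed B)) :
  [set u : bool * (seed A * seed B) | if u.1 then E u.2.1 else F u.2.2] =
  [set true] `*` (E `*` setT) `|` [set false] `*` (setT `*` F).
Proof.
apply/seteqP; split => -[c [a b]] /=; last by case=> -[/= -> []].
by case: c => h; [left|right].
Qed.

Lemma measurable_mix (E : set (seed A)) (F : set (seed B)) :
  measurable E -> measurable F ->
  measurable [set u : bool * (seed A * seed B) | if u.1 then E u.2.1 else F u.2.2].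
Proof.
by move=> mE mF; rewrite mix_set; apply: measurableU; apply: measurableX => //; exact: measurableX.
Qed.

Lemma mix_rule_measurable m ds fb a : measurable [set u | mix_rule m ds fb u = a].
Proof.
rewrite (_ : [set u | _] = [set u : bool * (seed A * seed B) |
  if u.1 then [set v : seed A | rule m ds fb v = a] u.2.1
  else [set v : seed B | rule m ds fb v = a] u.2.2]).
  by apply: measurable_mix; exact: rule_measurable.
by apply/seteqP; split => -[[] [a' b']].
Qed.

Definition mix_law : probability (bool * (seed A * seed B))%type R :=
  (bernoulli_prob t \x (seed_law A \x seed_law B))%E.

Definition mix_policy : policy R N :=
  @Policy R N _ (bool * (seed A * seed B))%type mix_law mix_rule mix_rule_measurable.

Lemma mix_lawE (E : set (seed A)) (F : set (seed B)) :
  measurable E -> measurable F ->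
  fine (mix_law [set u | if u.1 then E u.2.1 else F u.2.2]) =
  t * fine (seed_law A E) + (1 - t) * fine (seed_law B F).
Proof.
move=> mE mF.
have m1 : measurable ([set true] `*` (E `*` [set: seed B])).
  by apply: measurableX => //; exact: measurableX.
have m2 : measurable ([set false] `*` ([set: seed A] `*` F)).
  by apply: measurableX => //; exact: measurableX.
rewrite mix_set measureU//; last first.
  by apply/seteqP; split => // -[b v] [[/= -> _] [/= ? _]].
rewrite fineD ?fin_num_measure//.
have rect (C : set bool) (G : set (seed A)) (H : set (seed B)) :
    measurable G -> measurable H ->
    mix_law (C `*` (G `*` H)) = (bernoulli_prob t C * (seed_law A G * seed_law B H))%E.
  move=> mG mH; transitivity (bernoulli_prob t C * (seed_law A \x seed_law B) (G `*` H))%E.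
    by apply: product_measure1E => //; exact: measurableX.
  by congr (_ * _)%E; exact: product_measure1E.
have e1 : fine (mix_law ([set true] `*` (E `*` setT))) = t * fine (seed_law A E).
  rewrite rect// probability_setT mule1 bernoulli_probE// !diracE.
  by rewrite mem_set// memNset// mule1 mule0 adde0 fineM ?fin_num_measure.
have e2 : fine (mix_law ([set false] `*` (setT `*` F))) = (1 - t) * fine (seed_law B F).
  rewrite rect// probability_setT mul1e bernoulli_probE// !diracE.
  by rewrite memNset// mem_set// mule1 mule0 add0e fineM ?fin_num_measure.
by rewrite -e1 -e2.
Qed.

End mix.

Definition det_policy (f : seq (option 'I_N) -> seq (report N) -> option 'I_N) : policy R N.
Proof.
refine (@Policy R N _ unit (dirac tt) (fun _ ds fb _ => f ds fb) _) => //.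
Defined.

End policies.

(** * Success probabilities in a single slot *)

Section rates.
Context (R : realType) (N : nat) (p r : R) (PD : probability nat R).
Hypotheses (hp : 0 <= p <= 1) (hr : 0 <= r <= 1) (hpr : r < p)
  (hnd : p + (1 - r) < 2).
Context (m : nat) (L : downlink N p r PD m).
Local Notation ps := (stat_on p r).
Local Notation w := (delay_weight PD (m := m)).
Local Notation x0 := (fun=> [ffun=> false]).
Local Notation y0 := (fun=> [ffun=> ord0]).

Definition rate (A : policy R N) k i : R := fine (joint_law A L (scheduled_on (L := L) (A := A) k i)).

Lemma rate_ge0 A k i : 0 <= rate A k i.
Proof. exact: fine_ge0. Qed.

Lemma throughput_rate A i :
  throughput A L i = (\sum_(1 <= k < m.+1) rate A k i) / m%:R.
Proof. exact: throughputE. Qed.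

Lemma rate_mix (t : R) A B k i : 0 <= t <= 1 -> (0 < k <= m)%N ->
  rate (mix_policy t A B) k i = t * rate A k i + (1 - t) * rate B k i.
Proof.
move=> t01 km; rewrite /rate !scheduled_on_law// -!meanZ -meanD; apply: eq_mean => x y.
pose E (C : policy R N) := [set u : seed C | x k i /\ seed_act (A := C) k x y u = Some i].
have mE C : measurable (E C).
  exact: (measurable_outcome C k x y (fun _ a => x k i /\ a = Some i)).
transitivity (fine (mix_law t A B [set u | if u.1 then E A u.2.1 else E B u.2.2])).
  congr (fine (seed_law (mix_policy t A B) _)).
  by apply/seteqP; split => -[[] [a b]].
exact: (mix_lawE t01 (mE A) (mE B)).
Qed.

Lemma throughput_mix (t : R) A B i : 0 <= t <= 1 ->
  throughput (mix_policy t A B) L i = t * throughput A L i + (1 - t) * throughput B L i.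
Proof.
move=> t01; rewrite !throughput_rate !mulrA -mulrDl !mulr_sumr -big_split/=.
by congr (_ / _); apply: eq_big_nat => k; rewrite ltnS => km; exact: rate_mix.
Qed.

Lemma rate_det f k i : (0 < k <= m)%N ->
  rate (det_policy R f) k i = user_hit p r m w f k i.
Proof.
move=> km; rewrite /rate scheduled_on_law//; apply: eq_mean => x y.
pose a := act f (curry_chan x) (curry_delay y) m k.
transitivity (fine (\d_tt [set _ : unit | x k i /\ a = Some i]) : R); first by [].
rewrite diracE -natrM mulnb -/a; congr (nat_of_bool _)%:R.
apply/idP/idP; rewrite inE /=; first by move=> [xi ->]; rewrite eqxx.
by move=> /andP[/eqP ? ?].
Qed.

(** At most one user is scheduled, so the sum is the probability of a single event; for a fixed seed
    the policy is a deterministic rule and [mean_hit_le] applies. *)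
Lemma sum_rate_le A (V : {set 'I_N}) k : V != finset.set0 -> (0 < k <= m)%N ->
  \sum_(i in V) rate A k i <= gain p r PD #|V| (m - k).
Proof.
move=> /set0Pn[i0 i0V] km; have /andP[k0 km'] := km.
pose Phi (x : nat -> {ffun 'I_N -> bool}) (y : nat -> {ffun 'I_N -> 'I_m.+1}) u :=
  exists2 i, i \in V & x k i /\ seed_act (A := A) k x y u = Some i.
have loc : local_event Phi.
  move=> x x' y y' u xy [i iV h]; exists i => //.
  exact: (local_outcome (Psi := fun z _ a => z /\ a = Some i) km xy).
have mPhi x y : measurable [set u | Phi x y u].
  exact: (measurable_outcome A k x y (fun _ a => exists2 i, i \in V & x k i /\ a = Some i)).
have [mE JE] := joint_event hp hr hnd L loc mPhi.
have EE : [set v : dl_space L * seed A | Phi (chan_path (L := L) v.1) (delay_path (L := L) v.1) v.2] =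
    [set v | exists2 i, i \in V & scheduled_on (L := L) (A := A) k i v].
  apply/seteqP; split => v [i iV] [on a]; exists i => //; split.
  - by move: on; rewrite ffunE.
  - by rewrite actionE.
  - by rewrite ffunE.
  - by rewrite -actionE.
rewrite EE in mE JE; set E := [set v | _] in mE JE.
(* The default [i0] for an idle slot is harmless, since idling is excluded on [E]. *)
pose g (v : dl_space L * seed A) := odflt i0 (action k v).
have Eg i : E `&` [set v | g v = i] = if i \in V then scheduled_on (L := L) (A := A) k i else set0.
  case: ifPn => iV; apply/seteqP; split => v //.
  - by move=> [[j jV [on a]] <-]; rewrite /scheduled_on /= /g a.
  - by move=> [on a]; split; [exists i|rewrite /= /g a].
  - by move=> [[j jV [on a]] gi]; case/negP: iV; rewrite -gi /g a.
have -> : \sum_(i in V) rate A k i = fine (joint_law A L E).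
  rewrite (fine_fin_partition (joint_law A L) (g := g)) => [|i].
    rewrite big_mkcond; apply: eq_bigr => i _; rewrite Eg.
    by case: ifP => // _; rewrite measure0.
  by rewrite Eg; case: ifP => // _; exact: measurable_scheduled_on.
rewrite JE; apply: (joint_le hp hr hnd L loc mPhi) => u.
rewrite -(epoch_gainE p r PD (N := N) (m := m)) ?leq_subr//.
have := mean_hit_le x0 y0 (seed_rule m u) k0 km' i0 hp hr hpr hnd
  (delay_weight_ge0 PD (m := m)) (sum_delay_weight PD m) V.
congr (_ <= _); apply: eq_mean => x y; rewrite /hit sum_act.
case: asboolP => [[i iV [xi e]]|h].
  by move: e; rewrite /seed_act => ->; rewrite iV xi.
case e : (act _ _ _ _ _) => [i|//]; case: ifP => // iV.
by case xi : (x k i) => //; case: h; exists i.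
Qed.

End rates.

(** * The capacity region *)

Section region.
Context (R : realType) (N : nat) (p r : R) (PD : probability nat R).
Hypotheses (hp : 0 <= p <= 1) (hr : 0 <= r <= 1) (hpr : r < p)
  (hnd : p + (1 - r) < 2).
Context (L : forall m : nat, downlink N p r PD m).
Local Notation ps := (stat_on p r).

Lemma capacity_outer : capacity_region L `<=` outer_polyhedron p r PD (N := N).
Proof.
move=> x [A xA]; split=> [i|V].
  apply: (cvgr_to_ge (xA i)); apply: nearW => m.
  by rewrite (throughput_rate hp hr hnd) divr_ge0// sumr_ge0// => k _; exact: rate_ge0.
(* The empty set is treated apart because [gain_le] requires at least one user. *)
have [->|V0] := eqVneq V finset.set0.
  by rewrite big_set0 cards0; exact: Csum_genie_ge0.
have cv : (\sum_(i in V) throughput A (L m) i) @[m --> \oo] --> \sum_(i in V) x 0 i.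
  by apply: cvg_big => [|i _]; [exact: add_continuous|exact: xA].
apply: (cvgr_to_le cv); apply: nearW => m.
under eq_bigr do rewrite (throughput_rate hp hr hnd).
rewrite -mulr_suml exchange_big/=.
(* For the empty horizon the quotient by 0 is 0. *)
case: m => [|m]; first by rewrite invr0 mulr0 Csum_genie_ge0.
rewrite ler_pdivrMr//; set C := Csum_genie _ _ _ _.
have -> : C * m.+1%:R = \sum_(1 <= k < m.+2) C.
  by rewrite sumr_const_nat subn1 mulr_natr.
apply: ler_sum_nat => k; rewrite ltnS => km.
apply: (le_trans (sum_rate_le hp hr hpr hnd (L m.+1) A V0 km)).
by apply: gain_le => //; rewrite card_gt0.
Qed.

Lemma capacity_convex : convex_set (capacity_region L : set (convex_lmodType 'rV[R]_N)).
Proof.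
move=> x y t; rewrite !inE => -[A xA] [B yB].
have t01 : 0 <= t%:num <= 1 by apply/andP; split; [exact: ge0|exact: le1].
exists (mix_policy t%:num A B) => i.
rewrite [X in _ --> X](_ : _ = t%:num * x 0 i + (1 - t%:num) * y 0 i); last first.
  by rewrite /conv /= !mxE.
under eq_fun do rewrite (throughput_mix hp hr hnd)//.
by apply: cvgD; apply: cvgM; [exact: cvg_cst|exact: xA|exact: cvg_cst|exact: yB].
Qed.

Lemma idle_capacity : capacity_region L 0.
Proof.
exists (det_policy R (fun _ _ => None)) => i; rewrite mxE.
apply: cvg_near_cst; apply: nearW => m; rewrite (throughput_rate hp hr hnd).
rewrite big_nat_cond big1 ?mul0r// => k /andP[km _].
rewrite (rate_det hp hr hnd)//; apply: mean0 => // x y; by rewrite mul0r.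
Qed.

Lemma single_capacity i : capacity_region L (single_user_point p r i).
Proof.
exists (det_policy R (fun _ _ => Some i)) => j; rewrite mxE.
apply: cvg_near_cst; exists 1%N => // m /= m0; rewrite (throughput_rate hp hr hnd).
transitivity ((\sum_(1 <= k < m.+1) (if j == i then ps else 0)) / m%:R); last first.
  by rewrite sumr_const_nat subn1 /= -[X in X / _]mulr_natr mulfK// pnatr_eq0 -lt0n.
congr (_ / _); apply: eq_big_nat => k; rewrite ltnS => km.
rewrite (rate_det hp hr hnd)// /user_hit meanC.
have dk := @delay_is_kernel R N m.+1 _ (delay_weight_ge0 PD (m := m)) (sum_delay_weight PD m).
apply: (sweep_cst dk) => y _.
transitivity ((i == j)%:R * ps).
  exact: (chan_stationary hp hr hpr hnd j (i == j)%:R).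
by rewrite eq_sym; case: eqP; rewrite ?mul1r ?mul0r.
Qed.

Lemma two_user_capacity j k : j != k -> capacity_region L (two_user_point p r PD j k).
Proof.
move=> jk; pose A c := det_policy R (greedy j k c).
(* A fair choice of the starting user makes the two rates equal. *)
exists (mix_policy 2^-1 (A j) (A k)) => i; rewrite mxE.
have half : 0 <= (2^-1 : R) <= 1 by rewrite invr_ge0 ler0n invf_le1// ler1n.
pose V := [set j; k]%SET.
have jV : j \in V by rewrite !inE eqxx.
have kV : k \in V by rewrite !inE eqxx orbT.
have V2 : #|V| = 2%N by rewrite cards2 jk.
pose G m := (\sum_(1 <= s < m.+1) gain p r PD 2 (m - s)) / m%:R.
have GC : G m @[m --> \oo] --> Csum2 p r PD.
  by rewrite (Csum2E PD hnd); exact: cvg_gain_mean.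
have [iV|niV] := boolP (i \in V); last first.
  rewrite ifF; last by move: niV; rewrite !inE => /negbTE.
  apply: cvg_near_cst; apply: nearW => m; rewrite (throughput_rate hp hr hnd).
  rewrite big_nat_cond big1 ?mul0r// => s /andP[sm _].
  rewrite (rate_mix hp hr hnd)// !(rate_det hp hr hnd)//.
  have z c : c \in V -> user_hit p r m (delay_weight PD (m := m)) (greedy j k c) s i = 0.
    move=> cV; have sm' : (s <= m)%N by case/andP: sm.
    apply: mean0 => x y.
    have [u uV ->] := greedy_act (curry_chan x) (curry_delay y) cV sm'.
    rewrite eqE /=; case: eqP => [ui|_]; last by rewrite mul0r.
    by rewrite -ui uV in niV.
  by rewrite !z// !mulr0 addr0.
rewrite ifT; last by move: iV; rewrite !inE.
have -> : (fun m => throughput (mix_policy 2^-1 (A j) (A k)) (L m) i) = (fun m => G m * 2^-1).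
  apply/funext => m; rewrite (throughput_rate hp hr hnd) /G mulrAC; congr (_ / _).
  rewrite mulr_suml; apply: eq_big_nat => s sm'; have sm : (0 < s <= m)%N := sm'.
  rewrite (rate_mix hp hr hnd)// !(rate_det hp hr hnd)//.
  have /andP[s0 sm''] := sm.
  have -> : gain p r PD 2 (m - s) = epoch_gain p r (delay_weight PD (m := m)) V (m - s).
    by rewrite epoch_gainE ?leq_subr// V2.
  have e := user_hit_greedy hp hr hpr hnd (delay_weight_ge0 PD (m := m)) (sum_delay_weight PD m) jk.
  (* By symmetry the rate of one user under one start is that of the other user under the other
     start, so the two starts average to half the total gain. *)
  have sw := user_hit_swap j k p r m (delay_weight PD (m := m)).
  move: iV; rewrite !inE => /orP[]/eqP->.
    rewrite -(e _ _ _ jV sm) (sw k s j) tpermL tpermR; lra.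
  rewrite -(e _ _ _ jV sm) (sw k s k) !tpermR; lra.
apply: cvgM; [exact: GC|exact: cvg_cst].
Qed.

End region.

Theorem proposition9 (R : realType) (N : nat) (p r : R)
    (PD : probability nat R)
    (hp : 0 <= p <= 1) (hr : 0 <= r <= 1) (hpr : r < p)
    (hnd : p + (1 - r) < 2)
    (L : forall m : nat, downlink N p r PD m) :
  capacity_region L `<=` outer_polyhedron p r PD (N := N) /\
  convex_hull (inner_points p r PD (N := N)) `<=` capacity_region L.
Proof.
split; first exact: capacity_outer.
(* As the region is convex, only the three kinds of generating points remain. *)
apply: smallest_sub; first exact: capacity_convex.
move=> x [->|[i ->]|[j [k [jk ->]]]].
- exact: idle_capacity.
- exact: single_capacity.
- exact: two_user_capacity.
Qed.
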